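(* Assume the following set-theoretic assumption $( * )$: there is a proper class of cardinals $\kappa$ such that each stationary set $E'\subseteq\kappa^+$ has a non-reflecting stationary subset $E$. Let $R$ be an associative unital ring and let $M$ be a right $R$-module such that each module in $\varinjlim\mathrm{Add}(M)$ has an $\mathrm{Add}(M)$-cover. Then $M$ has a perfect decomposition. In particular, $\mathrm{Add}(M)$ is closed under direct limits.
   Context: We work in ZFC (plus the assumption $( * )$ where stated). ''Module'' means right $R$-module over the associative unital ring $R$; $\mathrm{Mod}\text{-}R$ denotes the category of all right $R$-modules. $\mathrm{Add}(M)$ is the class of all modules isomorphic to a direct summand of a direct sum of (arbitrarily many) copies of $M$. $\varinjlim\mathrm{Add}(M)$ is the class of all direct limits of directed systems of modules from $\mathrm{Add}(M)$. For a class $\mathcal C\subseteq\mathrm{Mod}\text{-}R$ and a module $L$, a $\mathcal C$-precover of $L$ is a homomorphism $f:C\to L$ with $C\in\mathcal C$ such that $\mathrm{Hom}_R(C',f):\mathrm{Hom}_R(C',C)\to\mathrm{Hom}_R(C',L)$ is surjective for each $C'\in\mathcal C$. A $\mathcal C$-cover of $L$ is a $\mathcal C$-precover $f:C\to L$ such that each $g\in\mathrm{End}_R(C)$ with $fg=f$ is an automorphism of $C$. (Precovers and covers are not required to be surjective.) A submodule of a module $N$ given as an internal direct sum $\bigoplus_{i\in I}N_i$ of submodules of $N$ is called a local direct summand in $N$ if the subsum $\bigoplus_{i\in J}N_i$ is a direct summand in $N$ for each finite $J\subseteq I$. A module $M$ has a perfect decomposition if every local direct summand in any module from $\mathrm{Add}(M)$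 is a direct summand. A subset of a limit ordinal $\alpha$ (of the regular cardinal $\kappa^+$, respectively) is stationary if it meets every closed unbounded subset of $\alpha$ (of $\kappa^+$, respectively). A subset $E\subseteq\kappa^+$ is non-reflecting if $E\cap\alpha$ is non-stationary in $\alpha$ for every limit ordinal $\alpha<\kappa^+$. *)

(* Defs.v *)
From HB Require Import structures.
From mathcomp Require Import all_boot all_order all_algebra.
From mathcomp Require Import boolp classical_sets functions cardinality fsbigop.
From mathcomp Require Import wochoice.

Set Implicit Arguments.
Unset Strict Implicit.
Unset Printing Implicit Defensive.

Import Order.TTheory GRing.Theory.

Local Open Scope classical_set_scope.
Local Open Scope card_scope.
Local Open Scope ring_scope.

(* Everything about modules is stated for left modules over an arbitrary ring
   [S]; right modules over [R] are the left modules over the converse ring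
   [R^c], with [r *: m] standing for [m r].  Rings are [pzRingType]s, so the
   zero ring is allowed. *)

(* External direct sum of copies of [V] indexed by [I]: the finitely supported
   functions from [I] to [V], as a submodule of the module of all functions. *)
Section DirectSum.
Variables (S : pzRingType) (I : choiceType) (V : lmodType S).

Definition fin_supp : {pred I -> V} :=
  [pred f : I -> V | `[< finite_set (f @^-1` [set~ 0]) >]].

Fact fin_supp_submod_closed : submod_closed fin_supp.
Proof.
split=> [|a f g]; rewrite !inE /=.
  apply: (@sub_finite_set _ _ set0) => // i.
  by rewrite /preimage /= => /(_ erefl).
move=> ffin gfin.
have: finite_set ((f @^-1` [set~ 0]) `|` (g @^-1` [set~ 0])).
  by rewrite finite_setU.
apply: sub_finite_set => i /= fgi; apply: contrapT => /not_orP[].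
move=> /contrapT fi0 /contrapT gi0; apply: fgi.
by rewrite /GRing.add /= /GRing.scale /= fi0 gi0 scaler0 addr0.
Qed.

HB.instance Definition _ :=
  GRing.isSubmodClosed.Build S (I -> V) fin_supp fin_supp_submod_closed.

Record dsum := Dsum { dsum_val :> I -> V; dsum_valP : dsum_val \in fin_supp }.

HB.instance Definition _ := [isSub for dsum_val].
HB.instance Definition _ := [Choice of dsum by <:].
HB.instance Definition _ := [SubChoice_isSubLmodule of dsum by <:].
End DirectSum.

Section Modules.
Variable S : pzRingType.
Implicit Types (L M N : lmodType S) (C : lmodType S -> Prop).

Definition submodule N (A : set N) : Prop := submod_closed [in A].

Definition direct_summand N (A : set N) : Prop :=
  submodule A /\
  exists B : set N, [/\ submodule B, A `&` B = [set 0] &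
    forall x, exists a b, [/\ A a, B b & x = a + b]].

Definition in_Add M N : Prop :=
  exists (I : choiceType) (f : {linear N -> dsum I M}),
    injective f /\ direct_summand (range f).

(* The submodule \sum_(i in J) N_i generated by the [A i] with [i] in [J]. *)
Definition subsum N (I : choiceType) (A : I -> set N) (J : set I) : set N :=
  [set x | exists y : I -> N,
    [/\ forall i, J i -> A i (y i), finite_set (J `&` y @^-1` [set~ 0]) &
        x = \sum_(i \in J) y i]].

Definition local_direct_summand N (I : choiceType) (A : I -> set N) : Prop :=
  [/\ forall i, submodule (A i),
      forall i, A i `&` subsum A [set~ i] = [set 0] &
      forall J : set I, finite_set J -> direct_summand (subsum A J)].

Definition perfect_decomposition M : Prop :=
  forall N, in_Add M N ->
  forall (I : choiceType) (A : I -> set N), local_direct_summand A ->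
    direct_summand (subsum A [set: I]).

Record directed_system d (I : porderType d) := DirectedSystem {
  ds_obj :> I -> lmodType S;
  ds_map : forall i j, (i <= j)%O -> {linear ds_obj i -> ds_obj j};
  ds_inhabited : inhabited I;
  ds_directed : forall i j : I, exists k, (i <= k)%O && (j <= k)%O;
  ds_map_id : forall i (ii : (i <= i)%O), ds_map ii =1 id;
  ds_map_comp : forall i j k (ij : (i <= j)%O) (jk : (j <= k)%O)
    (ik : (i <= k)%O), ds_map jk \o ds_map ij =1 ds_map ik
}.

Definition cocone d (I : porderType d) (F : directed_system I) L
    (g : forall i, {linear F i -> L}) : Prop :=
  forall i j (ij : (i <= j)%O), g j \o ds_map F ij =1 g i.

Definition is_direct_limit d (I : porderType d) (F : directed_system I) L
    (g : forall i, {linear F i -> L}) : Prop :=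
  cocone g /\
  forall N (h : forall i, {linear F i -> N}), cocone h ->
    exists u : {linear L -> N}, (forall i, u \o g i =1 h i) /\
      forall v : {linear L -> N}, (forall i, v \o g i =1 h i) -> v =1 u.

Definition in_lim C L : Prop :=
  exists d (I : porderType d) (F : directed_system I)
    (g : forall i, {linear F i -> L}),
    (forall i, C (F i)) /\ is_direct_limit g.

Definition is_precover C L N (f : {linear N -> L}) : Prop :=
  C N /\
  forall N', C N' -> forall g : {linear N' -> L},
    exists h : {linear N' -> N}, f \o h =1 g.

Definition is_cover C L N (f : {linear N -> L}) : Prop :=
  is_precover C f /\ forall g : {linear N -> N}, f \o g =1 f -> bijective g.

Definition has_cover C L : Prop :=
  exists (N : lmodType S) (f : {linear N -> L}), is_cover C f.

End Modules.

(* Sets of ordinals below an ordinal: the ambient ordinal is a well-ordered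
   type [W]; an element [a] of [W] is the ordinal given by the initial segment
   [below a], and [A : set W] below is either such a segment or [setT]. *)
Section Stationary.
Context {d : Order.disp_t} {W : orderType d}.
Implicit Types (A C E : set W) (a : W).

Definition below a : set W := [set x | (x < a)%O].

Definition limit_ordinal a : Prop :=
  (exists x, (x < a)%O) /\
  forall x, (x < a)%O -> exists y, (x < y)%O /\ (y < a)%O.

Definition unbounded_in A C : Prop :=
  forall x, A x -> exists y, [/\ A y, C y & (x < y)%O].

Definition club A C : Prop :=
  [/\ C `<=` A, unbounded_in A C &
      forall a, A a -> limit_ordinal a -> unbounded_in (below a) C -> C a].

Definition stationary A E : Prop :=
  E `<=` A /\ forall C, club A C -> E `&` C !=set0.

Definition non_reflecting E : Prop :=
  forall a, limit_ordinal a -> ~ stationary (below a) (E `&` below a).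

End Stationary.

(* A cardinal is given by a type of that cardinality.  [W] has the order type of
   the initial ordinal kappa^+, the least ordinal not embedding into kappa. *)
Definition successor_cardinal (kappa : choiceType) d (W : orderType d) : Prop :=
  [/\ well_order (<=%O : rel W), ~ ([set: W] #<= [set: kappa]) &
      forall a : W, below a #<= [set: kappa]].

Definition has_nonreflecting_subsets (kappa : choiceType) : Prop :=
  infinite_set [set: kappa] /\
  exists d (W : orderType d), successor_cardinal kappa W /\
    forall E' : set W, stationary setT E' ->
      exists E : set W, [/\ E `<=` E', stationary setT E & non_reflecting E].

(* The cardinals satisfying [P] do not form a set: no family indexed by a
   (small) type lists all of them up to equipotence. *)
Definition proper_class_of_cardinals (P : choiceType -> Prop) : Prop :=
  forall (I : choiceType) (K : I -> choiceType),
    exists kappa : choiceType, P kappa /\ forall i, [set: kappa] #!= [set: K i].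

(* Main.v *)
(* Everything reduces to showing that, in a module [N] of Add(M), the union of a
   directed family of direct summands is a direct summand.  An induction on
   cardinality (Iwamura) and then on the length of the chain reduces this to a
   direct sum [B] of submodules [e i N], [i] in a limit well-order [mu], all of
   whose proper initial subsums are summands of [N].

   Choose a large [kappa] as in the hypothesis and a nonreflecting stationary set
   [E] of ordinals [delta] below [kappa^+] carrying a ladder: a strictly increasing
   cofinal map [eta delta] from [mu] to [delta].  Let [X] be generated by points
   (copies of the [e i N] at the places [(beta, i)]) and by copies [N_delta] of [N],
   where the copy of [e i N] in [N_delta], [delta] in [E], is identified with the
   point at [(eta delta i, i)].  Since [E] does not reflect, ladders can be
   disjointified below each ordinal, so the part of [X] built from indices [<= a]
   is in Add(M).  Hence [X] is in lim Add(M) and has an Add(M)-cover.  As [M] has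
   at most [kappa] elements, every map from a finite sum of copies of [M] to [X]
   factors through one of these parts; this forces the cover to be injective, so
   [X] itself is in Add(M).  A closing-off argument then makes the part of [X]
   below [delta] a direct summand of [X] for some [delta] in [E].  This part also
   retracts onto the direct sum of the points on the ladder of [delta], and
   restricting the composite to [N_delta] splits [B] off [N]. *)
From HB Require Import structures.
Require Import Defs.
From mathcomp Require Import all_boot all_order all_algebra.
From mathcomp Require Import boolp classical_sets functions cardinality fsbigop.
From mathcomp Require Import wochoice.

Set Implicit Arguments.
Unset Strict Implicit.
Unset Printing Implicit Defensive.

Import Order.TTheory GRing.Theory.

Local Open Scope classical_set_scope.
Local Open Scope card_scope.
Local Open Scope ring_scope.

(** * Cardinals and well-orders *)

Lemma card_le_inj T U (A : set T) (B : set U) (f : T -> U) :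
  set_fun A B f -> {in A &, injective f} -> A #<= B.
Proof.
move=> fAB finj; have [|g] := (@injfunPex T U A B).2; first by exists f.
exact: inj_card_le.
Qed.

Lemma card_leT_inj T U (f : T -> U) : injective f -> [set: T] #<= [set: U].
Proof. by move=> finj; apply: (@card_le_inj _ _ _ _ f) => // x y _ _ /finj. Qed.

Lemma card_le_ex T U (A : set T) (B : set U) (u0 : U) : A #<= B ->
  exists f : T -> U, set_fun A B f /\ {in A &, injective f}.
Proof.
case/card_leP => g.
have inA x : A x -> x \in A by move/mem_set.
pose f x := if pselect (x \in A) is left p
            then val (g (exist (fun x => x \in A) x p)) else u0.
exists f; split.
  move=> x Ax; rewrite /f; case: pselect => [p|]; last by rewrite inA.
  exact: set_mem (valP (g _)).
move=> x y Ax Ay; rewrite /f; case: pselect => // p; case: pselect => // q.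
move/val_inj => /(@inj _ _ _ g); rewrite !inE => /(_ I I) [].
by [].
Qed.

(** Zorn's lemma on partial injections, each encoded as a domain with a total function that is
    compared only on the domain. A maximal one is defined everywhere or hits every element of
    [U]. *)
Lemma card_le_comparable T U : [set: T] #<= [set: U] \/ [set: U] #<= [set: T].
Proof.
have [[u0 _]|U0] := pselect (exists u : U, True); last first.
  right; have -> : [set: U] = set0; last exact: card_ge0.
  by apply/seteqP; split => // u _; case: U0; exists u.
pose X := {p : set T * (T -> U) | {in p.1 &, injective p.2}}.
pose mkX A f (fI : {in A &, injective f}) : X :=
  exist (fun p => {in p.1 &, injective p.2}) (A, f) fI.
pose R (p q : X) := `[< (sval p).1 `<=` (sval q).1 /\
   forall x, (sval p).1 x -> (sval p).2 x = (sval q).2 x >].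
have x0P : {in @set0 T &, injective (fun _ : T => u0)}.
  by move=> x y; rewrite in_set0.
have [||A totA|[[A f] /= finj] fmax] := @ZL_preorder X (mkX _ _ x0P) R.
- by move=> t; apply/asboolP; split.
- move=> r s t /asboolP[rs1 rs2] /asboolP[st1 st2]; apply/asboolP; split.
    by move=> x /rs1/st1.
  by move=> x rx; rewrite rs2// st2//; exact: rs1.
- pose D := [set x | exists2 p, A p & (sval p).1 x].
  have DI p x : A p -> (sval p).1 x -> D x by exists p.
  have pickP x : exists u, D x -> forall p, A p -> (sval p).1 x -> u = (sval p).2 x.
    have [[p Ap px]|nD] := pselect (D x); last by exists u0.
    exists ((sval p).2 x) => _ q Aq qx.
    by have [/asboolP[_ H]|/asboolP[_ H]] := totA _ _ Ap Aq; rewrite H.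
  have [f fP] := choice pickP.
  have finj : {in D &, injective f}.
    move=> x y; rewrite !inE => -[p Ap px] [q Aq qy].
    rewrite (fP x (DI _ _ Ap px) _ Ap px).
    rewrite (fP y (DI _ _ Aq qy) _ Aq qy).
    have [/asboolP[pq1 pq2]|/asboolP[qp1 qp2]] := totA _ _ Ap Aq.
      by rewrite pq2//; apply: (proj2_sig q); rewrite inE//; exact: pq1.
    by rewrite qp2//; apply: (proj2_sig p); rewrite inE//; exact: qp1.
  exists (mkX _ _ finj) => p Ap; apply/asboolP; split => /=.
    by move=> x px; exists p.
  by move=> x px; rewrite (fP x (DI _ _ Ap px) _ Ap px).
have [[t nAt]|allA] := pselect (exists t, ~ A t); last first.
  left; apply: (@card_leT_inj _ _ f) => x y; apply: (finj); rewrite inE;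
    by apply: contrapT => ?; apply: allA; eexists; eassumption.
have surjf : forall u, exists t, A t /\ f t = u.
  move=> u; apply: contrapT => nu.
  pose A' := A `|` [set t]; pose f' x := if pselect (x = t) is left _ then u else f x.
  have f'A x : A x -> f' x = f x by rewrite /f'; case: pselect => // ->.
  have f't : f' t = u by rewrite /f'; case: pselect.
  have f'P : {in A' &, injective f'}.
    move=> x y; rewrite !inE => -[Ax|->] [Ay|->] //; rewrite ?f't ?f'A//.
    - by apply: (finj); rewrite inE.
    - by move=> e; case: nu; exists x.
    - by move=> e; case: nu; exists y.
  have /asboolP[/= + _] : R (mkX _ _ f'P) (mkX _ _ finj).
    by apply: fmax; apply/asboolP; split => /= x Ax; [left | rewrite f'A].
  by move=> /(_ t (or_intror erefl)).
have [g gP] := choice surjf.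
right; apply: (@card_leT_inj _ _ g) => x y e.
by rewrite -(gP x).2 -(gP y).2 e.
Qed.

Lemma card_le_setX T U T' U' (A : set T) (B : set U) (A' : set T') (B' : set U') :
  A #<= A' -> B #<= B' -> A `*` B #<= A' `*` B'.
Proof.
have [[t0 A't0]|] := pselect (exists t, A' t); last first.
  move=> nA' AA' _; have A'0 : A' = set0.
    by apply/seteqP; split => // t A't; case: nA'; exists t.
  move: AA'; rewrite A'0 => /card_le0P ->.
  rewrite set0X.
  exact: card_ge0.
have [[u0 B'u0]|] := pselect (exists t, B' t); last first.
  move=> nA' _ AA'; have A'0 : B' = set0.
    by apply/seteqP; split => // t A't; case: nA'; exists t.
  move: AA'; rewrite A'0 => /card_le0P ->.
  rewrite setX0.
  exact: card_ge0.
move=> /(card_le_ex t0)[f [fA finj]] /(card_le_ex u0)[g [gB ginj]].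
apply: (@card_le_inj _ _ _ _ (fun p => (f p.1, g p.2))).
  by move=> [a b] [/= /fA ? /gB ?].
move=> [a b] [a' b']; rewrite !inE /= => -[Aa Bb] [Aa' Bb'] [/finj + /ginj].
by rewrite !inE => -> // ->.
Qed.

(** Zorn's lemma on injections of the square of an infinite set [A] into [A]. If the complement of a
    maximal [A] embeds in [A], then so does [T]; otherwise a copy of [A] inside the complement
    allows an extension to a larger square. *)
Lemma card_setX_infinite T : infinite_set [set: T] ->
  [set: T * T] #<= [set: T].
Proof.
move=> Tinf.
have [t0 _] : exists t : T, True.
  by have [t _] := infinite_setN0 Tinf; exists t.
have /(card_le_ex t0)[i0 [_ i0inj]] := (infiniteP _).1 Tinf.
have {}i0inj m n : i0 m = i0 n -> m = n by move/i0inj; apply; rewrite inE.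
pose good (A : set T) (f : T * T -> T) := [/\ infinite_set A,
  set_fun (A `*` A) A f & {in A `*` A &, injective f}].
pose X := {p : set T * (T * T -> T) | good p.1 p.2}.
pose mkX A f (fI : good A f) : X := exist (fun p => good p.1 p.2) (A, f) fI.
pose R (p q : X) := `[< (sval p).1 `<=` (sval q).1 /\
   forall x y, (sval p).1 x -> (sval p).1 y -> (sval p).2 (x, y) = (sval q).2 (x, y) >].
have [A0 [f0 x0]] : exists A f, good A f.
  have /choice[l lP] : forall t, exists n, forall m, t = i0 m -> n = m.
    move=> t; have [[m ->]|H] := pselect (exists m, t = i0 m).
      by exists m => k; exact: i0inj.
    by exists 0%N => m e; case: H; exists m.
  have lK m : l (i0 m) = m by exact: lP.
  exists (range i0), (fun p => i0 (pickle (l p.1, l p.2))); split.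
  - apply/infiniteP; apply: (@card_le_inj _ _ _ _ i0) => [n _|m n _ _ /i0inj//].
    by exists n.
  - by move=> p _ /=; eexists.
  - move=> [x1 x2] [y1 y2]; rewrite !inE => -[/= [a _ <-] [b _ <-]] [/= [c _ <-] [d _ <-]].
    by rewrite !lK => /i0inj/(pcan_inj pickleK)[-> ->].
have [||C totC|[[A f] /= fgood] fmax] := @ZL_preorder X (mkX _ _ x0) R.
- by move=> t; apply/asboolP; split.
- move=> r s t /asboolP[rs1 rs2] /asboolP[st1 st2]; apply/asboolP; split.
    by move=> x /rs1/st1.
  by move=> x y rx ry; rewrite rs2// st2//; exact: rs1.
- have [[p0 Cp0]|nC] := pselect (exists p, C p); last first.
    by exists (mkX _ _ x0) => s Cs; case: nC; exists s.
  pose D := [set x | exists2 p, C p & (sval p).1 x].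
  have both x y : D x -> D y -> exists2 p, C p & (sval p).1 x /\ (sval p).1 y.
    move=> [p Cp px] [q Cq qy].
    have [/asboolP[pq1 _]|/asboolP[qp1 _]] := totC _ _ Cp Cq.
      by exists q => //; split => //; exact: pq1.
    by exists p => //; split => //; exact: qp1.
  have agree p q x y : C p -> C q -> (sval p).1 x -> (sval p).1 y ->
      (sval q).1 x -> (sval q).1 y -> (sval p).2 (x, y) = (sval q).2 (x, y).
    move=> Cp Cq px py qx qy.
    by have [/asboolP[_ H]|/asboolP[_ H]] := totC _ _ Cp Cq; rewrite H.
  have /choice[g gP] : forall z : T * T, exists u, forall p, C p ->
      (sval p).1 z.1 -> (sval p).1 z.2 -> u = (sval p).2 z.
    move=> [x y]; have [[p Cp [px py]]|nD] :=
      pselect (exists2 p, C p & (sval p).1 x /\ (sval p).1 y).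
      by exists ((sval p).2 (x, y)) => q Cq qx qy; exact: agree.
    by exists t0 => p Cp px py; case: nD; exists p.
  have ggood : good D g.
    split.
    - have [inf _ _] := proj2_sig p0.
      by apply: sub_infinite_set inf => x p0x; exists p0.
    - move=> [x y] [/= Dx Dy]; have [p Cp [px py]] := both _ _ Dx Dy.
      rewrite (gP _ p)//; exists p => //.
      by have [_ + _] := proj2_sig p; apply.
    - move=> [x y] [x' y']; rewrite !inE => -[/= Dx Dy] [/= Dx' Dy'].
      have [p Cp [px py]] := both _ _ Dx Dy.
      have [q Cq [qx qy]] := both _ _ Dx' Dy'.
      rewrite (gP _ p)// (gP _ q)//.
      have [/asboolP[pq1 pq2]|/asboolP[qp1 qp2]] := totC _ _ Cp Cq.
        rewrite pq2//; have [_ _ +] := proj2_sig q; apply; rewrite inE; split => //=;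
          exact: pq1.
      rewrite qp2//; have [_ _ +] := proj2_sig p; apply; rewrite inE; split => //=;
          exact: qp1.
  exists (mkX _ _ ggood) => p Cp; apply/asboolP; split => /=.
    by move=> x px; exists p.
  by move=> x y px py; rewrite (gP _ p).
have [Ainf fA finj] := fgood.
have finj' a b c d : A a -> A b -> A c -> A d -> f (a, b) = f (c, d) ->
    a = c /\ b = d.
  by move=> Aa Ab Ac Ad /finj; rewrite !inE => /(_ (conj Aa Ab) (conj Ac Ad))[-> ->].
have fA' a b : A a -> A b -> A (f (a, b)) by move=> Aa Ab; exact: fA.
have /(card_le_ex t0)[j [jA jinj]] := (infiniteP _).1 Ainf.
have {}jinj m n : j m = j n -> m = n by move/jinj; apply; rewrite inE.
have {}jA n : A (j n) by exact: jA.
suff AT : [set: T] #<= A.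
  have -> : [set: T * T] = [set: T] `*` [set: T] by apply/seteqP.
  apply: (card_le_trans (card_le_setX AT AT)).
  by apply: (@card_le_trans _ _ _ A); [exact: (@card_le_inj _ _ _ _ f) | exact: card_leT].
have [] := card_le_comparable (set_type (~` A)) (set_type A).
  rewrite (card_le_eql (card_setT _)) (card_le_eqr (card_setT _)).
  move=> /(card_le_ex t0)[g [gA ginj]].
  pose h x := if pselect (A x) is left _ then f (x, j 0) else f (g x, j 1).
  apply: (@card_le_inj _ _ _ _ h) => [x _|x y _ _]; rewrite /h.
    by case: pselect => /= [Ax|nAx]; apply: fA' => //; exact: gA.
  case: pselect => /= [Ax|nAx]; case: pselect => /= [Ay|nAy] /finj'[]//.
  - by exact: gA.
  - by move=> _ /jinj.
  - by exact: gA.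
  - by move=> _ /jinj.
  - by exact: gA.
  - by exact: gA.
  - by move/ginj; rewrite !inE => /(_ nAx nAy).
rewrite (card_le_eql (card_setT _)) (card_le_eqr (card_setT _)).
move=> /(card_le_ex t0)[g [gA ginj]].
pose A' := A `|` g @` A.
have /choice[k kP] : forall y, exists x, A' y ->
    A x /\ (if pselect (A y) then x = y else y = g x).
  move=> y; case: pselect => [Ay|nAy]; first by exists y.
  have [[x Ax xy]|ny] := pselect ((g @` A) y); first by exists x.
  by exists t0 => -[].
have kA y : A' y -> A (k y) by move=> /kP[].
have kl y : A y -> k y = y by move=> Ay; have /kP[_] : A' y by [left]; case: pselect.
have kr y : A' y -> ~ A y -> y = g (k y) by move=> /kP[_]; case: pselect.
(* [k] folds [A'] onto [A], and [c] records which of the four blocks of the square a pair comes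
   from. Pairs outside the old block are coded in [A] by [f1] and moved to the copy by [g]. *)
pose c x y := if pselect (A x) is left _ then (if pselect (A y) is left _ then 0%N else 1%N)
   else (if pselect (A y) is left _ then 2%N else 3%N).
pose f1 p := f (f (k p.1, k p.2), j (c p.1 p.2)).
pose f' p := if c p.1 p.2 == 0%N then f p else g (f1 p).
have f1A p : A' p.1 -> A' p.2 -> A (f1 p).
  by move=> ? ?; apply: (fA') => //; apply: (fA'); exact: kA.
have f1inj p q : A' p.1 -> A' p.2 -> A' q.1 -> A' q.2 -> f1 p = f1 q -> p = q.
  case: p q => [x y] [x' y'] /= A'x A'y A'x' A'y' /finj'[];
    do ?[exact: jA | apply: fA'; exact: kA].
  move=> /finj'[]; do ?exact: kA.
  have aux u v : A' u -> A' v -> (A u <-> A v) -> k u = k v -> u = v.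
    move=> A'u A'v uv kuv; have [Au|nAu] := pselect (A u).
      by rewrite -(kl u)// kuv kl//; exact/uv.
    by rewrite (kr u)// kuv -kr// => /uv.
  move=> kx ky /jinj; rewrite /c.
  case: (pselect (A x)) => Ax; case: (pselect (A y)) => Ay;
  case: (pselect (A x')) => Ax'; case: (pselect (A y')) => Ay' //= _;
  by rewrite (aux x x')// (aux y y').
have c0 p : c p.1 p.2 = 0%N -> A p.1 /\ A p.2 by rewrite /c; do 2 case: pselect => //.
have f'good : good A' f'.
  split.
  - by apply: sub_infinite_set Ainf => x; left.
  - move=> p [A'1 A'2]; rewrite /f'; case: ifPn => [/eqP/c0[A1 A2]|_].
      by left; exact: fA.
    by right; exists (f1 p) => //; exact: f1A.
  - move=> p q; rewrite !inE => -[A'1 A'2] [A'3 A'4]; rewrite /f'.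
    case: ifPn => [/eqP/c0[A1 A2]|_]; case: ifPn => [/eqP/c0[A3 A4]|_].
    - by apply: (finj); rewrite inE.
    - by move=> e; case: (gA _ (f1A _ A'3 A'4)); rewrite -e; exact: fA.
    - by move=> e; case: (gA _ (f1A _ A'1 A'2)); rewrite e; exact: fA.
    - by move/ginj; rewrite !inE => /(_ (f1A _ A'1 A'2) (f1A _ A'3 A'4))/f1inj; apply.
have /asboolP[/= + _] : R (mkX _ _ f'good) (mkX _ _ fgood).
  apply: fmax; apply/asboolP; split => /= x; first by left.
  by move=> y Ax Ay; rewrite /f' /c /=; do 2 case: pselect => //.
move=> /(_ (g (j 0%N)) (or_intror (imageP g (jA 0%N)))).
by move/(gA _ (jA 0%N)).
Qed.

Lemma card_option_infinite T : infinite_set [set: T] ->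
  [set: option T] #<= [set: T].
Proof.
move=> Tinf; apply: card_le_trans (card_setX_infinite Tinf).
have [t0 _] := infinite_setN0 Tinf.
have [t1 t10] : exists t1, t1 <> t0.
  apply: contrapT => n; apply: Tinf; apply: (@sub_finite_set _ _ [set t0]) => //.
  by move=> t _; apply: contrapT => tt; apply: n; exists t.
apply: (@card_leT_inj _ _ (fun o => if o is Some t then (t, t0) else (t0, t1))).
by case=> [x|] [y|] // => [[->]|[_ /esym]|[_]].
Qed.

Lemma card_bigcup_infinite J T U (F : J -> set T) : infinite_set [set: U] ->
  [set: J] #<= [set: U] -> (forall i, F i #<= [set: U]) ->
  \bigcup_i F i #<= [set: U].
Proof.
move=> Uinf IU FU; apply: card_le_trans (card_setX_infinite Uinf).
have [u0 _] := infinite_setN0 Uinf.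
have /choice[g gP] : forall i, exists f : T -> U, {in F i &, injective f}.
  by move=> i; have /(card_le_ex u0)[f [_ ?]] := FU i; exists f.
have [h [_ hinj]] := card_le_ex u0 IU.
have /choice[k kP] : forall x, exists p, (\bigcup_i F i) x ->
    exists i, F i x /\ p = (h i, g i x).
  move=> x; have [[i _ Fix]|n] := pselect ((\bigcup_i F i) x).
    by exists (h i, g i x); exists i.
  by exists (u0, u0).
apply: (@card_le_inj _ _ _ _ k) => // x y.
rewrite !inE => /kP[i [Fx ->]] /kP[i' [Fy ->]] [] /hinj; rewrite !inE => /(_ I I).
move=> ii'; rewrite -ii' in Fy *.
by move=> /gP; apply; rewrite inE.
Qed.

Definition strict_wo (T : Type) (lt : T -> T -> Prop) :=
  [/\ well_founded lt, forall x y z, lt x y -> lt y z -> lt x z &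
      forall x y, [\/ lt x y, x = y | lt y x]].

(** The default [a0] fills the values outside the initial segment, which [F] does not see. *)
Lemma wf_recursion T A (a0 : A) (lt : T -> T -> Prop)
    (F : (T -> A) -> T -> A) : well_founded lt ->
    (forall t f g, (forall x, lt x t -> f x = g x) -> F f t = F g t) ->
  exists f : T -> A, forall t, f t = F f t.
Proof.
move=> wf Fext.
pose G t (rec : forall x, lt x t -> A) : A :=
  F (fun x => if pselect (lt x t) is left p then rec x p else a0) t.
exists (Fix wf (fun=> A) G) => t; rewrite Fix_eq; last first.
  move=> x f g fg; rewrite /G; apply: Fext => y yx.
  by case: pselect => // p; exact: fg.
by apply: Fext => x xt; case: pselect.
Qed.

Lemma strict_wo_irr T (lt : T -> T -> Prop) x : strict_wo lt -> ~ lt x x.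
Proof. by case=> wf _ _; elim/(well_founded_ind wf): x => x IH /[dup] /IH. Qed.

Lemma wf_least T (lt : T -> T -> Prop) (P : T -> Prop) : strict_wo lt ->
  (exists x, P x) -> exists x, P x /\ forall y, P y -> lt x y \/ x = y.
Proof.
move=> wo [x]; have [wf _ tot] := wo.
elim/(well_founded_ind wf): x => x IH Px.
have [[y [yx Py]]|n] := pselect (exists y, lt y x /\ P y); first exact: IH yx Py.
exists x; split => // y Py; case: (tot x y) => [||yx]; [by left|by right|].
by case: n; exists y.
Qed.

Lemma strict_wo_sub T (lt : T -> T -> Prop) (A : set T) : strict_wo lt ->
  strict_wo (fun x y : set_type A => lt (val x) (val y)).
Proof.
move=> [wf tr tot]; split.
- suff H a (x : set_type A) : val x = a -> Acc (fun x y : set_type A => lt (val x) (val y)) x.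
    by move=> x; exact: (H _ _ erefl).
  elim/(well_founded_ind wf): a x => a IH x xa; constructor => y yx.
  by apply: (IH (val y)) => //; rewrite -xa.
- by move=> x y z; exact: tr.
- move=> x y; have [] := tot (val x) (val y); [by constructor 1| |by constructor 3].
  by move=> /val_inj; constructor 2.
Qed.

Lemma strict_wo_rel (T : eqType) (R : rel T) : well_order R ->
  strict_wo (fun x y => R x y && (x != y)).
Proof.
move=> Rwo; have RwoT : wo_chain R predT by move=> A _; exact: Rwo.
have Rtot x y : R x y || R y x by apply: (wo_chainW RwoT).
have Ranti x y : R x y -> R y x -> x = y.
  by move=> *; apply: (wo_chain_antisymmetric RwoT) => //; apply/andP.
have min (A : T -> Prop) : (exists x, A x) -> exists x, A x /\ forall y, A y -> R x y.
  move=> [x Ax]; have [|z [[Az zmin] _]] := Rwo [pred x | `[< A x >]].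
    by exists x; apply/asboolP.
  exists z; split; first exact/asboolP.
  by move=> y Ay; apply: zmin; apply/asboolP.
(* Transitivity comes from a least element of the set of [x], [y], [z] together with
   antisymmetry. *)
have Rtr x y z : R x y -> R y z -> R x z.
  move=> xy yz; have [|m [mxyz mmin]] := min (fun t => [\/ t = x, t = y | t = z]).
    by exists x; constructor 1.
  have Rmx : R m x by apply: mmin; constructor 1.
  have Rmy : R m y by apply: mmin; constructor 2.
  have Rmz : R m z by apply: mmin; constructor 3.
  case: mxyz => e; rewrite e in Rmx Rmy Rmz => //; first by rewrite (Ranti x y).
  by rewrite -(Ranti y z).
split.
- move=> x; apply: contrapT => nx.
  have [|z [nz zmin]] := min (fun z => ~ Acc (fun x y => R x y && (x != y)) z).
    by exists x.
  apply: nz; constructor => y /andP[yz /eqP nyz]; apply: contrapT => /zmin zy.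
  by apply: nyz; exact: Ranti.
- move=> x y z /andP[xy /eqP nxy] /andP[yz nyz]; rewrite (Rtr x y z)//=.
  by apply/eqP => xz; apply: nxy; apply: Ranti => //; rewrite xz.
- move=> x y; have [->|xy] := eqVneq x y; first by constructor 2.
  have /orP[xRy|yRx] := Rtot x y; first by constructor 1; rewrite xRy.
  by constructor 3; rewrite yRx.
Qed.

Lemma exists_strict_wo (T : Type) : exists lt : T -> T -> Prop, strict_wo lt.
Proof.
elim/Peq: T => T; have [R Rwo] := well_ordering_principle T.
by eexists; exact: strict_wo_rel Rwo.
Qed.

Lemma strict_wo_lt d (W : orderType d) : well_order (<=%O : rel W) ->
  strict_wo (fun x y : W => (x < y)%O).
Proof.
move=> /strict_wo_rel; congr strict_wo; apply/funext => x; apply/funext => y.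
by rewrite lt_def andbC eq_sym.
Qed.

(** * Successor cardinals *)

Section SuccessorCardinal.
Variables (kappa : choiceType) (d : Order.disp_t) (W : orderType d).
Hypotheses (kappa_inf : infinite_set [set: kappa])
  (Wsucc : successor_cardinal kappa W).

Lemma succ_le_card (a : W) : [set x | (x <= a)%O] #<= [set: kappa].
Proof.
have [_ _ Wb] := Wsucc; have [k0 _] := infinite_setN0 kappa_inf.
apply: card_le_trans (card_option_infinite kappa_inf).
have /(card_le_ex k0)[f [_ finj]] := Wb a.
apply: (@card_le_inj _ _ _ _ (fun x => if x == a then None else Some (f x))) => //.
move=> x y; rewrite !inE /= => xa ya.
case: (eqVneq x a) xa => [->|xa] xlea; case: (eqVneq y a) ya => [->|ya] ylea //.
by case=> /finj; apply; rewrite inE /below /= lt_neqAle ?xa ?ya.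
Qed.

(** Regularity of the successor cardinal: without a bound, [W] would be a union of at most [kappa]
    initial segments, each of size at most [kappa]. *)
Lemma succ_bound T (A : set T) (h : T -> W) : A #<= [set: kappa] ->
  exists w, forall a, A a -> (h a < w)%O.
Proof.
move=> Ak; apply: contrapT => n; have [_ + _] := Wsucc; apply.
have -> : [set: W] = \bigcup_(a : set_type A) [set x | (x <= h (val a))%O].
  apply/seteqP; split => // w _; apply: contrapT => nw; apply: n; exists w => a Aa.
  rewrite ltNge; apply/negP => wh; apply: nw.
  by exists (exist _ a (mem_set Aa)).
apply: card_bigcup_infinite => // [|a]; last exact: succ_le_card.
by rewrite (card_le_eql (card_setT _)).
Qed.

Lemma succ_bound1 (a : W) : exists w, (a < w)%O.
Proof.
have k1 : [set: unit] #<= [set: kappa].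
  by apply: card_le_trans ((infiniteP _).1 kappa_inf); exact: finite_set_countable.
by have [w wP] := succ_bound (fun=> a) k1; exists w; exact: wP tt I.
Qed.

End SuccessorCardinal.

(** Applied to the family of all subsets of [U], the hypothesis yields a cardinal that is not
    equipotent to any subset of [U]; comparability then puts it above [U]. *)
Lemma large_nonreflecting_cardinal :
  proper_class_of_cardinals has_nonreflecting_subsets ->
  forall U : choiceType, exists kappa : choiceType,
    has_nonreflecting_subsets kappa /\ [set: U] #<= [set: kappa].
Proof.
move=> star U.
have [kappa [kP kne]] := star (set U) (fun A : set U => set_type A).
exists kappa; split => //.
have [kU|//] := card_le_comparable kappa U.
have [u0|U0] := pselect (exists u : U, True); last first.
  by have -> : [set: U] = set0 by apply/seteqP; split => // u _; case: U0; exists u.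
have [u _] := u0.
have [f [_ finj]] := card_le_ex u kU.
have /negP[] := kne (range f).
apply: (card_eq_trans (B := range f)).
  by rewrite card_eq_sym; apply: inj_card_eq.
by rewrite card_eq_sym card_setT.
Qed.

(** * Iwamura's reduction of directed unions to chains *)

Section BinaryClosure.
Variables (T : Type) (J : T -> T -> T).
Hypothesis Jidem : forall x, J x x = x.

Definition closed_under (A : set T) := forall x y, A x -> A y -> A (J x y).

(** Idempotence of [J] makes these stages increase. *)
Fixpoint closure_step (B : set T) n : set T :=
  if n is n'.+1 then
    [set J p.1 p.2 | p in closure_step B n' `*` closure_step B n'] else B.

Definition closure (B : set T) : set T := \bigcup_n closure_step B n.

Lemma sub_closure B : B `<=` closure B.
Proof. by move=> x Bx; exists 0%N. Qed.

Lemma closure_step_mono B m n : (m <= n)%N -> closure_step B m `<=` closure_step B n.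
Proof.
move=> /subnK <-; elim: (n - m)%N => [//|k IH] x /IH xk.
by rewrite addSn /=; exists (x, x).
Qed.

Lemma closure_closed B : closed_under (closure B).
Proof.
move=> x y [m _ xm] [n _ yn]; exists (maxn m n).+1 => //=.
by exists (x, y) => //; split; [apply: closure_step_mono xm|apply: closure_step_mono yn];
  rewrite ?leq_maxl ?leq_maxr.
Qed.

Lemma closure_min A B : closed_under A -> B `<=` A -> closure B `<=` A.
Proof.
move=> Acl BA x [n _]; elim: n x => [x /BA//|n IH] _ [[x y] [/= xn yn] <-].
by apply: Acl; exact: IH.
Qed.

Lemma closure_card B U : infinite_set [set: U] -> B #<= [set: U] ->
  closure B #<= [set: U].
Proof.
move=> Uinf BU; apply: card_bigcup_infinite => //; first exact/infiniteP.
elim=> [//|n IH] /=.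
apply: (card_le_trans (card_image_le _ _)).
apply: card_le_trans (card_setX_infinite Uinf).
by apply: (card_le_trans (card_le_setX IH IH)); exact: card_leT.
Qed.

End BinaryClosure.

Section DirectedUnion.
Variables (N : Type) (Q : set N -> Prop).
Hypothesis Qchain : forall (I : Type) (lt : I -> I -> Prop) (B : I -> set N),
  strict_wo lt -> inhabited I -> (forall i j, lt i j -> B i `<=` B j) ->
  (forall i, Q (B i)) -> Q (\bigcup_i B i).
Variables (I : Type) (F : I -> set N) (J : I -> I -> I).
Hypotheses (QF : forall i, Q (F i)) (Jidem : forall i, J i i = i)
  (JF : forall i j, F i `<=` F (J i j) /\ F j `<=` F (J i j)).

Let union_chain (T : Type) (lt : T -> T -> Prop) (A : T -> set I) :
  strict_wo lt -> inhabited T -> (forall i j, lt i j -> A i `<=` A j) ->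
  (forall i, Q (\bigcup_(x in A i) F x)) -> Q (\bigcup_(x in \bigcup_i A i) F x).
Proof.
move=> wo T0 Amono QA; rewrite bigcup_bigcup; apply: (Qchain wo) => //.
by move=> i j ij; apply: bigcup_subset; exact: Amono.
Qed.

(** Joining the enumerated elements one after another gives indices [c n] whose sets increase and
    exhaust the union. *)
Let union_countable (A : set I) : A !=set0 -> closed_under J A ->
  A #<= [set: nat] -> Q (\bigcup_(x in A) F x).
Proof.
move=> [a0 Aa0] Acl /(card_le_ex 0%N)[f [_ finj]].
have /choice[e eP] : forall n, exists x, A x /\ forall y, A y -> f y = n -> y = x.
  move=> n; have [[x [Ax fx]]|H] := pselect (exists x, A x /\ f x = n).
    by exists x; split => // y Ay fy; apply: finj; rewrite ?inE// fy.
  by exists a0; split => // y Ay fy; case: H; exists y.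
pose c := fix c n := if n is n'.+1 then J (c n') (e n'.+1) else e 0%N.
have Ac n : A (c n).
  by elim: n => [|n IH] /=; [exact: (eP _).1|apply: Acl => //; exact: (eP _).1].
have cS n : F (c n) `<=` F (c n.+1) by exact: (JF _ _).1.
have ce n : F (e n) `<=` F (c n) by case: n => [//|n]; exact: (JF _ _).2.
have -> : \bigcup_(x in A) F x = \bigcup_n F (c n).
  apply/seteqP; split => [x [a Aa Fax]|x [n _ Fx]]; last by exists (c n).
  by exists (f a) => //; apply: ce; rewrite -((eP (f a)).2 a).
apply: (@Qchain nat (fun m n => m < n)%N).
- split.
  + by move=> n; elim/ltn_ind: n => n IH; constructor => m; exact: IH.
  + by move=> x y z; exact: ltn_trans.
  + by move=> x y; case: (ltngtP x y) => ?; [constructor 1|constructor 3|constructor 2].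
- exact: (inhabits 0%N).
- move=> m n mn; rewrite -(subnK mn); elim: (n - m.+1)%N => [//|k IH] x /IH.
  by rewrite addSn; exact: cS.
- by move=> n; exact: QF.
Qed.

(** An injection into a well-order writes [A] as a chain of closures of initial pieces. Closing off
    stays within the size of the initial segment if that is infinite, and induction applies; finite
    segments fall under the countable case. *)
Let union_step (lt : I -> I -> Prop) (D A : set I) : strict_wo lt ->
  (forall s, D s -> forall A', A' !=set0 -> closed_under J A' ->
     A' #<= [set x | lt x s] -> Q (\bigcup_(x in A') F x)) ->
  A !=set0 -> closed_under J A -> A #<= D -> Q (\bigcup_(x in A) F x).
Proof.
move=> wo IH [a0 Aa0] Acl /(card_le_ex a0)[f [fD finj]].
have [wf tr tot] := wo.
pose B s := [set a | A a /\ (f a = s \/ lt (f a) s)].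
have -> : A = \bigcup_(s : set_type (f @` A)) closure J (B (val s)).
  apply/seteqP; split => [a Aa|a [s _]]; last first.
    by move: a; apply: closure_min => // a [].
  exists (exist _ (f a) (mem_set (imageP f Aa))) => //=.
  by apply: sub_closure; split => //; left.
apply: (union_chain (strict_wo_sub (f @` A) wo)).
- exact: (inhabits (exist _ (f a0) (mem_set (imageP f Aa0)))).
- move=> s s' ss'; apply: closure_min; first exact: closure_closed.
  move=> a [Aa fas]; apply: sub_closure; split => //; right.
  by case: fas => [->//|fas]; exact: tr ss'.
move=> [s sP] /=; have [a Aa fas] := set_mem sP.
have clB : closed_under J (closure J (B s)) by exact: closure_closed.
have clB0 : closure J (B s) !=set0.
  by exists a; apply: sub_closure; split => //; left.
have BL : B s #<= [set x | x = s \/ lt x s].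
  apply: (@card_le_inj _ _ _ _ f); first by move=> x [].
  by move=> x y; rewrite !inE => -[Ax _] [Ay _]; apply: finj; rewrite inE.
have [Lfin|Linf] := pselect (finite_set [set x | lt x s]).
  apply: union_countable => //; apply: closure_card => //; first exact: infinite_nat.
  apply: (card_le_trans BL); apply: finite_set_countable.
  rewrite (_ : [set x | _] = [set s] `|` [set x | lt x s]).
    by rewrite finite_setU; split => //; exact: finite_set1.
  by apply/seteqP; split.
apply: (IH s) => //; first by rewrite -fas; exact: fD.
pose L := set_type [set x | lt x s].
have Linf' : infinite_set [set: L].
  by rewrite (eq_finite_set (card_setT _)).
rewrite -(card_le_eqr (card_setT _)); apply: closure_card => //.
apply: (card_le_trans BL); apply: card_le_trans (card_option_infinite Linf').
pose g x : option L := if pselect (lt x s) is left p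
  then Some (exist _ x (mem_set p)) else None.
apply: (@card_le_inj _ _ _ _ g) => // x y; rewrite !inE /g.
have irr := strict_wo_irr (x := s) wo.
move=> [->|xs] [->|ys] //; (do ?case: pselect) => // *.
by congruence.
Qed.

Lemma union_of_closed : inhabited I -> Q (\bigcup_i F i).
Proof.
move=> [i0]; have [lt wo] := exists_strict_wo I.
have [wf _ _] := wo.
(* Induction treats the sets that embed in a proper initial segment; one more step with the whole
   order then reaches [I]. *)
have all t : forall A', A' !=set0 -> closed_under J A' ->
     A' #<= [set x | lt x t] -> Q (\bigcup_(x in A') F x).
  elim/(well_founded_ind wf): t => t IH A' A'0 A'cl A't.
  by apply: (union_step wo (D := [set x | lt x t])).
by apply: (union_step wo (D := setT)) => [s _||//|]; [exact: all|exists i0|exact: card_lexx].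
Qed.

End DirectedUnion.

Lemma directed_union_of_chains N (Q : set N -> Prop) :
  (forall (I : Type) (lt : I -> I -> Prop) (B : I -> set N),
    strict_wo lt -> inhabited I -> (forall i j, lt i j -> B i `<=` B j) ->
    (forall i, Q (B i)) -> Q (\bigcup_i B i)) ->
  forall (I : Type) (F : I -> set N), inhabited I ->
    (forall i j, exists k, F i `<=` F k /\ F j `<=` F k) ->
    (forall i, Q (F i)) -> Q (\bigcup_i F i).
Proof.
move=> Qchain I F I0 Fdir QF.
have /choice[J JP] : forall p : I * I, exists k,
    [/\ F p.1 `<=` F k, F p.2 `<=` F k & (p.1 = p.2 -> k = p.1)].
  move=> [i j]; have [<-|ij] := pselect (i = j).
    by exists i; split.
  by have [k [ik jk]] := Fdir i j; exists k; split.
apply: (@union_of_closed _ _ Qchain I F (fun i j => J (i, j))) => //.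
- by move=> i; have [_ _ ->] := JP (i, i).
- by move=> i j; have [] := JP (i, j).
Qed.

(** * Linear maps, quotients and direct sums *)

Section LinearMaps.
Variable S : pzRingType.
Implicit Types A B T N : lmodType S.

Definition mk_linear A B (f : A -> B) (fl : linear f) : {linear A -> B} :=
  HB.pack f (GRing.isLinear.Build S A B *:%R f fl).

(** Two values at one point differ by a value at 0, so the relation is a graph. Maps whose formulas
    involve choices are built this way: factorizations, corestrictions, maps out of direct sums and
    directed unions. *)
Lemma linear_of_relation A T (R : A -> T -> Prop) :
  (forall x, exists y, R x y) -> (forall y, R 0 y -> y = 0) ->
  (forall a x y x' y', R x y -> R x' y' -> R (a *: x + x') (a *: y + y')) ->
  exists t : {linear A -> T}, forall x, R x (t x).
Proof.
move=> /choice[f fP] R0 Rlin.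
have Rfun x y y' : R x y -> R x y' -> y' = y.
  move=> xy xy'; apply/eqP; rewrite -subr_eq0; apply/eqP/R0.
  by have := Rlin (-1) _ _ _ _ xy xy'; rewrite !scaleN1r addNr addrC.
have fl : linear f.
  by move=> a x y; apply: Rfun (Rlin a _ _ _ _ (fP x) (fP y)) (fP _).
by exists (mk_linear fl).
Qed.

Lemma linear_factor A B T (p : {linear A -> B}) (u : {linear A -> T}) :
  (forall y, exists x, p x = y) -> (forall x, p x = 0 -> u x = 0) ->
  exists t : {linear B -> T}, forall x, t (p x) = u x.
Proof.
move=> psurj ker.
have [y|y [x [px <-]]|a y z y' z' [x [<- <-]] [x' [<- <-]]|t tP] :=
  @linear_of_relation B T (fun y z => exists x, p x = y /\ u x = z).
- by have [x <-] := psurj y; exists (u x); exists x.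
- exact: ker.
- by exists (a *: x + x'); rewrite !linearP.
exists t => x; have [x' [pxx' <-]] := tP (p x).
by apply/eqP; rewrite -subr_eq0 -linearB; apply/eqP/ker; rewrite linearB pxx' subrr.
Qed.

Lemma linear_corestrict A B N (i : {linear B -> N}) (f : {linear A -> N}) :
  injective i -> (forall x, exists y, i y = f x) ->
  exists t : {linear A -> B}, forall x, i (t x) = f x.
Proof.
move=> iinj fi; apply: (@linear_of_relation A B (fun x y => i y = f x)) => //.
- by move=> y; rewrite linear0 -(linear0 i) => /iinj.
- by move=> a x y x' y'; rewrite !linearP => -> ->.
Qed.

Lemma submodule0 N (A : set N) : submodule A -> A 0.
Proof. by case=> + _; rewrite inE. Qed.

Lemma submoduleP N (A : set N) : submodule A ->
  forall a x y, A x -> A y -> A (a *: x + y).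
Proof. by case=> _ H a x y Ax Ay; have := H a x y; rewrite !inE; apply. Qed.

Lemma submoduleD N (A : set N) : submodule A -> forall x y, A x -> A y -> A (x + y).
Proof. by move=> sA x y Ax Ay; rewrite -[x]scale1r; exact: submoduleP. Qed.

Lemma submoduleZ N (A : set N) : submodule A -> forall a x, A x -> A (a *: x).
Proof.
by move=> sA a x Ax; rewrite -[a *: x]addr0; apply: submoduleP => //; exact: submodule0.
Qed.

Lemma submoduleB N (A : set N) : submodule A -> forall x y, A x -> A y -> A (x - y).
Proof.
by move=> sA x y Ax Ay; apply: submoduleD => //; rewrite -scaleN1r; exact: submoduleZ.
Qed.

Lemma submodule_intro N (A : set N) : A 0 ->
  (forall a x y, A x -> A y -> A (a *: x + y)) -> submodule A.
Proof. by move=> A0 AP; split => [|a x y]; rewrite !inE //; exact: AP. Qed.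

Lemma submodule_sum N (A : set N) (I : Type) (r : seq I) (F : I -> N) :
  submodule A -> (forall i, A (F i)) -> A (\sum_(i <- r) F i).
Proof.
move=> sA AF; elim: r => [|i r IH]; first by rewrite big_nil; exact: submodule0.
by rewrite big_cons; exact: submoduleD.
Qed.

Lemma submodule_range A N (f : {linear A -> N}) : submodule (range f).
Proof.
apply: submodule_intro; first by exists 0; rewrite ?linear0.
by move=> a _ _ [x _ <-] [y _ <-]; exists (a *: x + y); rewrite ?linearP.
Qed.

End LinearMaps.

Section Submodule.
Variables (S : pzRingType) (N : lmodType S) (A : set N).
Hypothesis sA : submodule A.

(** The proof of [submodule A] is an argument so that the module structure can be attached to the
    predicate and to the type built on it. *)
Definition submod_pred & submodule A : {pred N} := [in A].
Fact submod_pred_closed : submod_closed (submod_pred sA). Proof. exact: sA. Qed.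
HB.instance Definition _ :=
  GRing.isSubmodClosed.Build S N (submod_pred sA) submod_pred_closed.
Record submod := Submod { submod_val :> N; submod_valP : submod_val \in submod_pred sA }.
HB.instance Definition _ := [isSub for submod_val].
HB.instance Definition _ := [Choice of submod by <:].
HB.instance Definition _ := [SubChoice_isSubLmodule of submod by <:].

Lemma submodule_type : exists (U : lmodType S) (i : {linear U -> N}),
  injective i /\ range i = A.
Proof.
exists submod, (val : {linear submod -> N}); split; first exact: val_inj.
apply/seteqP; split => [_ [x _ <-]|x Ax]; first exact: set_mem (submod_valP x).
by exists (Submod (mem_set Ax : x \in submod_pred sA)).
Qed.

End Submodule.

Section Quotient.
Variables (S : pzRingType) (N : lmodType S) (K : set N).
Hypothesis sK : submodule K.

(** Congruent elements determine the same coset, hence the same chosen representative; the quotient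
    lives on the fixed points of this choice. *)
Definition coset_repr (x : N) : N := xget 0 [set y | K (y - x)].

Let repr_sub x : K (coset_repr x - x).
Proof.
apply: (@xgetPex _ 0 [set y | K (y - x)]); exists x => /=.
by rewrite subrr; exact: submodule0.
Qed.

Let repr_eq x y : K (x - y) -> coset_repr x = coset_repr y.
Proof.
move=> Kxy; rewrite /coset_repr; congr xget; apply/seteqP; split => z /= Kz.
  by rewrite -(subrK x z) -addrA; exact: submoduleD.
by rewrite -(subrK y z) -addrA -(opprB x y); exact: submoduleB.
Qed.

Definition coset_type of submodule K := {x : N | coset_repr x == x}.
Notation Q := (coset_type sK).
Let cpi x : Q := exist _ (coset_repr x) (introT eqP (repr_eq (repr_sub x))).

Let cpiP x y : K (x - y) -> cpi x = cpi y.
Proof. by move=> /repr_eq e; apply: val_inj => /=. Qed.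

Let cpi_val (q : Q) : cpi (val q) = q.
Proof. by apply: val_inj => /=; exact/eqP/(valP q). Qed.

Let cpi_inv x y : cpi x = cpi y -> K (x - y).
Proof.
move=> [e]; rewrite -(subrK (coset_repr x) x) -addrA {2}e.
by apply: submoduleD => //; rewrite -opprB -sub0r; apply: submoduleB => //; exact: submodule0.
Qed.

HB.instance Definition _ := Choice.on Q.

Let qadd (q r : Q) := cpi (val q + val r).
Let qopp (q : Q) := cpi (- val q).
Let qscale (a : S) (q : Q) := cpi (a *: val q).

Let piD x y : qadd (cpi x) (cpi y) = cpi (x + y).
Proof. by apply: cpiP => /=; rewrite opprD addrACA; exact: submoduleD. Qed.

Let piN x : qopp (cpi x) = cpi (- x).
Proof.
apply: cpiP => /=; rewrite -opprD -sub0r; apply: submoduleB => //.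
exact: submodule0.
Qed.

Let piZ a x : qscale a (cpi x) = cpi (a *: x).
Proof. by apply: cpiP => /=; rewrite -scalerBr; exact: submoduleZ. Qed.

Let qaddA : associative qadd.
Proof.
move=> q r s; rewrite -(cpi_val q) -(cpi_val r) -(cpi_val s).
by rewrite !piD addrA.
Qed.

Let qaddC : commutative qadd.
Proof. by move=> q r; rewrite /qadd addrC. Qed.

Let qadd0 : left_id (cpi 0) qadd.
Proof. by move=> q; rewrite -(cpi_val q) piD add0r. Qed.

Let qaddN : left_inverse (cpi 0) qopp qadd.
Proof. by move=> q; rewrite -(cpi_val q) piN piD addNr. Qed.

HB.instance Definition _ := GRing.isZmodule.Build Q qaddA qaddC qadd0 qaddN.

Let qscaleA a b (q : Q) : qscale a (qscale b q) = qscale (a * b) q.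
Proof. by rewrite -(cpi_val q) !piZ scalerA. Qed.

Let qscale1 : left_id 1 qscale.
Proof. by move=> q; rewrite -(cpi_val q) piZ scale1r. Qed.

Let qscaleDr : right_distributive qscale +%R.
Proof.
move=> a q r; rewrite -(cpi_val q) -(cpi_val r).
by rewrite [cpi _ + _]piD !piZ [RHS]piD scalerDr.
Qed.

Let qscaleDl (q : Q) : {morph qscale^~ q : a b / a + b}.
Proof. by move=> a b; rewrite -(cpi_val q) !piZ [RHS]piD scalerDl. Qed.

HB.instance Definition _ := GRing.Zmodule_isLmodule.Build S Q
  qscaleA qscale1 qscaleDr qscaleDl.

Lemma quotient_type : exists (X : lmodType S) (p : {linear N -> X}),
  (forall y, exists x, p x = y) /\ (forall x, p x = 0 <-> K x).
Proof.
have pl : linear (cpi : N -> Q).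
  by move=> a x y; rewrite -[RHS]/(qadd (qscale a (cpi x)) (cpi y)) piZ piD.
exists Q, (mk_linear pl); split => [q|x].
  by exists (val q); exact: cpi_val.
split => [/cpi_inv|Kx]; first by rewrite subr0.
by apply: cpiP; rewrite subr0.
Qed.

End Quotient.

Section DsumTheory.
Variables (S : pzRingType) (I : choiceType) (V : lmodType S).
Implicit Types (T : lmodType S) (y : dsum I V).

Lemma dsum_ext (y z : dsum I V) : (forall i, y i = z i) -> y = z.
Proof. by move=> yz; apply: val_inj; apply/funext. Qed.

Lemma dsum_supp y : exists2 s : seq I, uniq s & forall i, y i <> 0 -> i \in s.
Proof.
have /asboolP/finite_seqP[s sE] := dsum_valP y.
exists (undup s); first exact: undup_uniq.
move=> i yi; rewrite mem_undup; have : (y @^-1` [set~ 0]) i by [].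
by rewrite sE.
Qed.

Lemma dsumD (y z : dsum I V) i : (y + z) i = y i + z i. Proof. by []. Qed.
Lemma dsumZ a y i : (a *: y) i = a *: y i. Proof. by []. Qed.
Lemma dsum_sum (J : Type) (r : seq J) (F : J -> dsum I V) i :
  (\sum_(j <- r) F j) i = \sum_(j <- r) F j i.
Proof. by elim: r => [|j r IH]; rewrite ?big_nil// !big_cons dsumD IH. Qed.

Fact dsum_in_subproof i (v : V) :
  (fun j : I => if j == i then v else 0) \in @fin_supp S I V.
Proof.
rewrite inE; apply/asboolP; apply/asboolP; apply: (@sub_finite_set _ _ [set i]) => // j /=.
by case: eqP.
Qed.
Definition dsum_in i v : dsum I V := Dsum (dsum_in_subproof i v).

Lemma dsum_inE i v j : dsum_in i v j = if j == i then v else 0.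
Proof. by []. Qed.

Lemma dsum_in_linear i : linear (dsum_in i).
Proof.
move=> a u v; apply: dsum_ext => j; rewrite dsumD dsumZ !dsum_inE.
by case: ifP => // _; rewrite scaler0 addr0.
Qed.
HB.instance Definition _ i := GRing.isLinear.Build S V (dsum I V) *:%R (dsum_in i)
  (dsum_in_linear i).

Fact dsum_restrict_subproof (A : set I) y :
  (fun j : I => if `[< A j >] then y j else 0) \in @fin_supp S I V.
Proof.
rewrite inE; apply/asboolP; apply/asboolP; have /asboolP := dsum_valP y.
by apply: sub_finite_set => j /=; case: ifP.
Qed.
Definition dsum_restrict A y : dsum I V := Dsum (dsum_restrict_subproof A y).

Lemma dsum_restrictE A y j : dsum_restrict A y j = if `[< A j >] then y j else 0.
Proof. by []. Qed.

Lemma dsum_restrict_linear A : linear (dsum_restrict A).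
Proof.
move=> a u v; apply: dsum_ext => j; rewrite dsumD dsumZ !dsum_restrictE dsumD dsumZ.
by case: ifP => // _; rewrite scaler0 addr0.
Qed.
HB.instance Definition _ A := GRing.isLinear.Build S (dsum I V) (dsum I V) *:%R
  (dsum_restrict A) (dsum_restrict_linear A).

Lemma dsum_restrict_id (A : set I) y : (forall i, y i <> 0 -> A i) ->
  dsum_restrict A y = y.
Proof.
move=> yA; apply: dsum_ext => i; rewrite dsum_restrictE; case: asboolP => // nA.
by apply/esym; apply: contrapT => /yA.
Qed.

Lemma dsum_restrict_in (A : set I) i v : A i ->
  dsum_restrict A (dsum_in i v) = dsum_in i v.
Proof.
by move=> Ai; apply: dsum_restrict_id => j; rewrite dsum_inE; case: eqP => // ->.
Qed.

Lemma sum_seq1 (T : zmodType) (s : seq I) (F : I -> T) j : uniq s ->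
  (forall i, i != j -> F i = 0) -> (F j <> 0 -> j \in s) -> \sum_(i <- s) F i = F j.
Proof.
move=> us F0 Fj; case js: (j \in s).
  by rewrite (bigD1_seq j)//= big1 ?addr0.
have -> : F j = 0 by apply: contrapT => /Fj; rewrite js.
rewrite big_seq big1// => i si; apply: F0; apply: contraTneq si => ->.
by rewrite js.
Qed.

Lemma dsum_expand y (s : seq I) : uniq s -> (forall i, y i <> 0 -> i \in s) ->
  y = \sum_(i <- s) dsum_in i (y i).
Proof.
move=> us sy; apply: dsum_ext => j; rewrite dsum_sum.
under eq_bigr do rewrite dsum_inE.
rewrite (@sum_seq1 _ s _ j)// ?eqxx//; last exact: sy.
by move=> i ij; rewrite eq_sym (negbTE ij).
Qed.

Lemma dsum_submodule_ind (P : set (dsum I V)) : submodule P ->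
  forall y, (forall i, y i <> 0 -> forall v, P (dsum_in i v)) -> P y.
Proof.
move=> sP y Py; have [s us sy] := dsum_supp y; rewrite (dsum_expand us sy).
apply: submodule_sum => // i; have [->|/eqP/Py//] := eqVneq (y i) 0.
by rewrite linear0; exact: submodule0.
Qed.

(** The relation [R] allows any duplicate-free list covering the support. Padding a list adds only
    zero terms, so two elements can be summed over a common list, which gives linearity. *)
Lemma dsum_lift T (r : I -> {linear V -> T}) :
  exists t : {linear dsum I V -> T}, forall i v, t (dsum_in i v) = r i v.
Proof.
pose R y t := exists s : seq I, [/\ uniq s, forall i, y i <> 0 -> i \in s &
  t = \sum_(i <- s) r i (y i)].
have widen y (s s' : seq I) : uniq s -> uniq s' -> {subset s <= s'} ->
    (forall i, y i <> 0 -> i \in s) ->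
    \sum_(i <- s) r i (y i) = \sum_(i <- s') r i (y i).
  move=> us us' ss' sy; rewrite [RHS](bigID (fun i => i \in s))/=.
  rewrite [X in _ + X]big1 ?addr0.
    rewrite -[RHS]big_filter; apply: perm_big; apply: uniq_perm => //.
      exact: filter_uniq.
    by move=> i; rewrite mem_filter; case: (boolP (i \in s)) => [/ss'->|].
  move=> i nis; have -> : y i = 0; last exact: linear0.
  by apply: contrapT => /sy; rewrite (negbTE nis).
have [y|t [s [us _ ->]]|a y t y' t' [s [us sy ->]] [s' [us' sy' ->]]|t tP] :=
  @linear_of_relation S (dsum I V) T R.
- by have [s us sy] := dsum_supp y; exists (\sum_(i <- s) r i (y i)), s.
- by rewrite big1// => i _; rewrite linear0.
- pose s2 := undup (s ++ s').
  have s2u : uniq s2 by exact: undup_uniq.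
  have ss2 : {subset s <= s2} by move=> i si; rewrite mem_undup mem_cat si.
  have ss2' : {subset s' <= s2} by move=> i si; rewrite mem_undup mem_cat si orbT.
  rewrite (widen y _ _ us s2u ss2 sy) (widen y' _ _ us' s2u ss2' sy').
  exists s2; split => //.
    move=> i yi; have [yi0|/eqP/sy/ss2//] := eqVneq (y i) 0.
    apply/ss2'/sy' => yi'0; apply: yi.
    by rewrite dsumD dsumZ yi0 yi'0 scaler0 addr0.
  rewrite scaler_sumr -big_split /=; apply: eq_bigr => i _.
  by rewrite -linearP.
exists t => i v; have [s [us sy ->]] := tP (dsum_in i v).
rewrite (@sum_seq1 _ s _ i)// ?dsum_inE ?eqxx//.
  by move=> j ji; rewrite dsum_inE (negbTE ji) linear0.
by move=> rv; apply: sy; rewrite dsum_inE eqxx => v0; apply: rv; rewrite v0 linear0.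
Qed.

Lemma dsum_linear_ext T (f g : {linear dsum I V -> T}) :
  (forall i v, f (dsum_in i v) = g (dsum_in i v)) -> f =1 g.
Proof.
move=> fg y; apply: (@dsum_submodule_ind [set y | f y = g y]) => [|i _ v//].
apply: submodule_intro => [|a x z /= fx fz]; first by rewrite /= !linear0.
by rewrite !linearP fx fz.
Qed.

End DsumTheory.

Section Retracts.
Variable S : pzRingType.
Implicit Types M N P T : lmodType S.

Definition retract N P := exists (i : {linear N -> P}) (p : {linear P -> N}), cancel i p.

Lemma retract_trans N P T : retract N P -> retract P T -> retract N T.
Proof.
move=> [i [p ip]] [j [q jq]]; exists (j \o i : {linear _ -> _}), (p \o q : {linear _ -> _}).
by move=> x /=; rewrite jq ip.
Qed.

(** Given [e], its kernel is a complement. Conversely, decomposing [x] along a complement is a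
    linear relation with unique values. Summands are handled through such projections from here
    on. *)
Lemma direct_summandP N (A : set N) : direct_summand A <->
  exists e : {linear N -> N}, (forall x, A (e x)) /\ (forall x, A x -> e x = x).
Proof.
split=> [[sA [B [sB AB0 AB]]]|[e [eA eid]]]; last first.
  split.
    apply: submodule_intro => [|a x y Ax Ay]; first by rewrite -(linear0 e).
    by rewrite -(eid _ Ax) -(eid _ Ay) -linearP.
  exists [set x | e x = 0]; split.
  - apply: submodule_intro => [|a x y /= ex ey]; first by rewrite /= linear0.
    by rewrite linearP ex ey scaler0 addr0.
  - apply/seteqP; split => [x [Ax /= ex]|_ ->].
      by rewrite /= -(eid _ Ax).
    by split; [rewrite -(linear0 e)|rewrite /= linear0].
  - move=> x; exists (e x), (x - e x); split => //=.
      by rewrite linearB (eid _ (eA x)) subrr.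
    by rewrite addrC subrK.
have [x|y [A0 /= B0]|a x y x' y' [/= Ay By] [/= Ay' By']|e eP] :=
  @linear_of_relation S N N (fun x a => A a /\ B (x - a)).
- by have [a [b [Aa Bb ->]]] := AB x; exists a; rewrite addrC addrA addNr add0r.
- have : (A `&` B) y.
    split => //; rewrite -[y]opprK -sub0r; apply: submoduleB => //; first exact: submodule0.
    by rewrite -sub0r.
  by rewrite AB0.
- split; first exact: submoduleP.
  by rewrite opprD addrACA -scalerBr; exact: submoduleP.
exists e; split => [x|x Ax]; first exact: (eP x).1.
have : (A `&` B) (x - e x).
  by split; [apply: submoduleB => //|]; case: (eP x).
by rewrite AB0 /= => /eqP; rewrite subr_eq0 => /eqP.
Qed.

Lemma in_AddP M N : in_Add M N <-> exists I : choiceType, retract N (dsum I M).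
Proof.
split=> [[I [f [finj /direct_summandP[e [ef eid]]]]]|[I [i [p ip]]]].
  exists I; have [g gP]
    := linear_corestrict finj (fun x => let: ex_intro2 y _ H := ef x in ex_intro _ y H).
  by exists f, g => x; apply: finj; rewrite gP eid//; exists x.
exists I, i; split; first exact: can_inj ip.
apply/direct_summandP; exists (i \o p : {linear _ -> _}); split.
  by move=> x; exists (p x).
by move=> _ [x _ <-] /=; rewrite ip.
Qed.

Lemma in_Add_retract M N P : retract N P -> in_Add M P -> in_Add M N.
Proof.
by move=> NP /in_AddP[I PI]; apply/in_AddP; exists I; exact: retract_trans PI.
Qed.

Lemma retract_dsum (I : choiceType) N P : retract N P -> retract (dsum I N) (dsum I P).
Proof.
move=> [i [p ip]].
have [f fP] := dsum_lift (fun k => (@dsum_in S I P k) \o i : {linear _ -> _}).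
have [g gP] := dsum_lift (fun k => (@dsum_in S I N k) \o p : {linear _ -> _}).
exists f, g => y; apply: (@dsum_linear_ext _ _ _ _ (g \o f : {linear _ -> _}) idfun).
by move=> k v /=; rewrite fP /= gP /= ip.
Qed.

Lemma in_Add_dsum (I : choiceType) M N : in_Add M N -> in_Add M (dsum I N).
Proof.
move=> /in_AddP[J NJ]; apply/in_AddP; exists (I * J)%type.
apply: retract_trans (retract_dsum I NJ) _.
have /choice[h hP] : forall i, exists t : {linear dsum J M -> dsum (I * J)%type M},
    forall j v, t (dsum_in j v) = dsum_in (i, j) v.
  by move=> i; exact: (@dsum_lift _ _ _ _
    (fun j => @dsum_in S (I * J)%type M (i, j) : {linear _ -> _})).
have [f fP] := dsum_lift h.
have [g gP] := @dsum_lift S (I * J)%type M _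
  (fun ij => (@dsum_in S I _ ij.1) \o (@dsum_in S J M ij.2) : {linear _ -> _}).
exists f, g => y; apply: (@dsum_linear_ext _ _ _ _ (g \o f : {linear _ -> _}) idfun).
move=> k v /=; rewrite fP.
apply: (@dsum_linear_ext _ _ _ _ (g \o h k : {linear _ -> _})
  (@dsum_in S I _ k : {linear _ -> _})).
by move=> j u /=; rewrite hP gP.
Qed.

End Retracts.

(** * Ladder systems on nonreflecting sets *)

Section Ladders.
Variables (d : Order.disp_t) (W : orderType d).
Hypothesis Wwo : strict_wo (fun x y : W => (x < y)%O).
Variables (mu : Type) (lt : mu -> mu -> Prop).
Hypothesis mu_wo : strict_wo lt.

Definition ladder (delta : W) (eta : mu -> W) :=
  [/\ forall i j, lt i j -> (eta i < eta j)%O, forall i, (eta i < delta)%O &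
      forall x, (x < delta)%O -> exists i, (x < eta i)%O].

Lemma ladder_lt delta eta i j : ladder delta eta -> (eta i < eta j)%O -> lt i j.
Proof.
move=> [eta_mono _ _] ij; have [_ _ tot] := mu_wo.
case: (tot i j) => // [e|ji]; first by rewrite e ltxx in ij.
by have := lt_trans ij (eta_mono _ _ ji); rewrite ltxx.
Qed.

Lemma ladder_limit (delta : W) eta : inhabited mu -> ladder delta eta ->
  limit_ordinal delta.
Proof.
move=> [i0] [_ eta_lt eta_cof]; split; first by exists (eta i0).
by move=> x /eta_cof[i xi]; exists (eta i).
Qed.

Lemma wo_max2 (a b : mu) : exists m, forall i, lt i a \/ lt i b -> lt i m.
Proof.
have [_ tr tot] := mu_wo; case: (tot a b) => [ab|->|ba].
- by exists b => i [|//] ia; exact: tr ab.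
- by exists b => i [].
- by exists a => i [//|] ib; exact: tr ba.
Qed.

Variables (E : set W) (eta : W -> mu -> W).
Hypotheses (mu0 : inhabited mu) (Eladder : forall delta, E delta -> ladder delta (eta delta))
  (Enr : non_reflecting E).

(** Only coincidences at equal indices matter, because the points of the glued module carry the
    index [i]. *)
Definition disjointifies (A : set W) (f : W -> mu) := forall x y, A x -> A y ->
  x <> y -> forall i, eta x i = eta y i -> lt i (f x) \/ lt i (f y).

(* Tails of the ladders of [E] below [alpha] can be chosen pairwise disjoint:
   at a limit [alpha], a club of [alpha] missing [E] cuts [E] into intervals. *)
Lemma ladders_disjointifiable alpha :
  exists f, disjointifies (E `&` below alpha) f.
Proof.
have [wf _ _] := Wwo; elim/(well_founded_ind wf): alpha => alpha IH.
have /choice[f fP] : forall b, exists f, (b < alpha)%O -> disjointifies (E `&` below b) f.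
  move=> b; have [ba|nba] := pselect (b < alpha)%O.
    by have [f ?] := IH _ ba; exists f.
  by have [i] := mu0; exists (fun=> i).
have [alim|] := pselect (limit_ordinal alpha); last first.
  move=> nlim; have [[x0 x0a]|na] := pselect (exists x, (x < alpha)%O); last first.
    by have [i] := mu0; exists (fun=> i)
      => x y [_ xa]; case: na; exists x.
  have [b [ba bmax]] : exists b, (b < alpha)%O /\ forall y, (b < y)%O -> ~ (y < alpha)%O.
    apply: contrapT => n; apply: nlim; split; first by exists x0.
    move=> x xa; apply: contrapT => n2; apply: n; exists x; split => // y xy ya.
    by apply: n2; exists y.
  (* From index [g x] on, the ladder of the predecessor [b] of [alpha] lies above [x], hence above
     the whole ladder of [x]. *)
  have /choice[g gP] : forall x, exists i, E b -> (x < b)%O -> (x < eta b i)%O.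
    move=> x; have [[Eb xb]|n] := pselect (E b /\ (x < b)%O).
      by have [_ _ /(_ _ xb)[i]] := Eladder Eb; exists i.
    by have [i] := mu0; exists i => Eb xb; case: n.
  have /choice[h hP] : forall x, exists m, forall i, lt i (f b x) \/ lt i (g x) -> lt i m.
    by move=> x; exact: wo_max2.
  have step x i : E b -> E x -> (x < b)%O -> eta b i = eta x i -> lt i (h x).
    move=> Eb Ex xb e; apply: hP; right; apply: (ladder_lt (Eladder Eb)).
    rewrite e; have [_ + _] := Eladder Ex; move=> /(_ i) xi.
    exact: lt_trans xi (gP x Eb xb).
  exists h => x y [Ex xa] [Ey ya] xy i e.
  have leb z : (z < alpha)%O -> (z <= b)%O.
    by move=> za; rewrite leNgt; apply/negP => /bmax.
  have := leb _ xa; rewrite le_eqVlt => /orP[/eqP xb|xb].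
    have := leb _ ya; rewrite le_eqVlt => /orP[/eqP yb|yb].
      by case: xy; rewrite xb yb.
    by right; apply: step => //; rewrite -xb.
  have := leb _ ya; rewrite le_eqVlt => /orP[/eqP yb|yb].
    by left; apply: step => //; rewrite -yb.
  by have [fx|fy] := fP b ba x y (conj Ex xb) (conj Ey yb) xy i e;
    [left|right]; apply: hP; left.
have [C [Csub Cunb Ccl] CE] : exists2 C, club (below alpha) C & forall x, C x -> ~ E x.
  apply: contrapT => n; apply: (Enr alim); split; first by move=> x [].
  move=> C Cclub; apply: contrapT => nC; apply: n; exists C => // x Cx Ex.
  by apply: nC; exists x; split => //; split => //; case: Cclub => + _ _; apply.
(* [c x] is the next club element after [x]; ladders of points with the same [c x] are separated by
   the function [f (c x)] from the induction. *)
have /choice[c cP] : forall x, exists c, (x < alpha)%O ->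
    [/\ C c, (x < c)%O & forall c', C c' -> (x < c')%O -> (c <= c')%O].
  move=> x; have [xa|nxa] := pselect (x < alpha)%O; last by exists x.
  have [|c [[Cc xc] cmin]] := @wf_least _ _ (fun c => C c /\ (x < c)%O) Wwo.
    by have [y [_ Cy xy]] := Cunb _ xa; exists y.
  exists c => _; split => // c' Cc' xc'.
  by have [/ltW|->] := cmin c' (conj Cc' xc').
(* A point [x] of [E] is a limit outside the closed set [C], so the part of [C] before [x] is
   bounded in [x]. From [g x] on, the ladder of [x] has passed all club elements before [x], hence
   all ladders from earlier intervals. *)
have /choice[g gP] : forall x, exists i, E x -> (x < alpha)%O ->
    forall c, C c -> (c < x)%O -> (c <= eta x i)%O.
  move=> x; have [[Ex xa]|n] := pselect (E x /\ (x < alpha)%O); last first.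
    by have [i] := mu0; exists i => Ex xa; case: n.
  have [b [bx bmax]] : exists b, (b < x)%O /\ forall y, C y -> (y < x)%O -> (y <= b)%O.
    apply: contrapT => n; apply: (CE x) => //; apply: Ccl => //.
      exact: ladder_limit (Eladder Ex).
    move=> b bx; apply: contrapT => n2; apply: n; exists b; split => // y Cy yx.
    by rewrite leNgt; apply/negP => xy; apply: n2; exists y.
  have [_ _ /(_ _ bx)[i bi]] := Eladder Ex.
  by exists i => _ _ c' Cc' /(bmax _ Cc') /le_lt_trans /(_ bi) /ltW.
have /choice[h hP] : forall x, exists m, forall i,
    lt i (f (c x) x) \/ lt i (g x) -> lt i m.
  by move=> x; exact: wo_max2.
exists h.
suff main x y i : E x -> E y -> (x < y)%O -> (y < alpha)%O -> eta x i = eta y i ->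
    lt i (h x) \/ lt i (h y).
  move=> x y [Ex xa] [Ey ya] xy i e; case: (ltgtP x y) => // [xy'|yx].
    exact: main.
  by have [] := main y x i Ey Ex yx xa (esym e); [right|left].
move=> Ex Ey xy ya e; have xa := lt_trans xy ya.
have [Ccx xcx cxmin] := cP _ xa; have [Ccy ycy cymin] := cP _ ya.
have [ycx|cxy] := ltP y (c x).
  have cxy : c x = c y.
    apply: le_anti; rewrite cxmin// ?(lt_trans xy)//=; exact: cymin.
  have cxa : (c x < alpha)%O by exact: Csub.
  have xy' : x <> y by move=> xy'; rewrite xy' ltxx in xy.
  have [fx|fy] := fP _ cxa x y (conj Ex xcx) (conj Ey ycx) xy' i e.
    by left; apply: hP; left.
  by right; apply: hP; left; rewrite -cxy.
right; apply: hP; right; apply: (ladder_lt (Eladder Ey)); rewrite -e.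
have [_ /(_ i) xi _] := Eladder Ex.
have cxy' : (c x < y)%O.
  rewrite lt_neqAle cxy andbT; apply/eqP => cxy'; apply: (CE y) => //.
  by rewrite -cxy'.
exact: lt_le_trans (lt_trans xi xcx) (gP _ Ey ya _ Ccx cxy').
Qed.

End Ladders.

(** * Clubs and stationary sets in a successor cardinal *)

Section Clubs.
Variables (kappa : choiceType) (d : Order.disp_t) (W : orderType d).
Hypotheses (kappa_inf : infinite_set [set: kappa])
  (Wsucc : successor_cardinal kappa W).

Let Wwo : strict_wo (fun x y : W => (x < y)%O).
Proof. by have [wo _ _] := Wsucc; exact: strict_wo_lt. Qed.

Lemma succ_lub T (A : set T) (h : T -> W) : A #<= [set: kappa] ->
  exists s, (forall a, A a -> (h a <= s)%O) /\
    forall x, (x < s)%O -> exists a, A a /\ (x < h a)%O.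
Proof.
move=> Ak; have [|s [sub smin]] := @wf_least _ _ (fun s => forall a, A a -> (h a <= s)%O) Wwo.
  by have [w wP] := succ_bound kappa_inf Wsucc h Ak; exists w => a /wP/ltW.
exists s; split => // x xs; apply: contrapT => n.
have [a Aa|sx|sx] := smin x.
- by rewrite leNgt; apply/negP => xa; apply: n; exists a.
- by have := lt_trans xs sx; rewrite ltxx.
- by rewrite sx ltxx in xs.
Qed.

(** Closure points above [x] are suprema of countable iterations of a function that dominates [h] on
    initial segments. *)
Lemma club_closed_under (h : W -> W) :
  club setT [set x | limit_ordinal x /\ forall y, (y < x)%O -> (h y < x)%O].
Proof.
split => // [x _|a _ alim aunb]; last first.
  split => // y ya; have [z [za [_ zh] yz]] := aunb _ ya.
  exact: lt_trans (zh _ yz) za.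
have /choice[g gP] : forall y, exists z, (y < z)%O /\ forall t, (t <= y)%O -> (h t < z)%O.
  move=> y; have [z zP] := succ_bound kappa_inf Wsucc h (succ_le_card kappa_inf Wsucc y).
  have [z' yz'] := succ_bound1 kappa_inf Wsucc y.
  exists (Order.max z z'); split; first by rewrite lt_max yz' orbT.
  by move=> t /zP tz; rewrite lt_max tz.
pose u n := iter n g (g x).
have uS n : (u n < u n.+1)%O by exact: (gP _).1.
have [s [us sP]] := succ_lub u ((infiniteP _).1 kappa_inf).
have uls n : (u n < s)%O by apply: lt_le_trans (uS n) (us _ I).
exists s; split => //; last by apply: lt_trans (uls 0%N); exact: (gP _).1.
split; first by split; [exists (u 0%N)|move=> y /sP[n [_ yn]]; exists (u n)].
by move=> y /sP[n [_ /ltW/((gP _).2) yn]]; exact: lt_trans (uls n.+1).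
Qed.

Variables (mu : Type) (lt : mu -> mu -> Prop).
Hypotheses (mu_wo : strict_wo lt) (mu0 : inhabited mu)
  (mu_nomax : forall i, exists j, lt i j) (mu_card : [set: mu] #<= [set: kappa]).

(** Inside any club a strictly increasing [mu]-sequence is built by recursion, each step by
    regularity. Its supremum lies in the club and has the sequence as a ladder, since [mu] has no
    last element. *)
Lemma stationary_ladders :
  stationary setT [set x : W | exists eta : mu -> W, ladder lt x eta].
Proof.
split => // C [_ Cunb Ccl]; have [wf tr tot] := mu_wo; have [i0] := mu0.
have [w0 _] : exists w : W, True.
  apply: contrapT => n; have [_ + _] := Wsucc; apply.
  have -> : [set: W] = set0 by apply/seteqP; split => // w _; case: n; exists w.
  exact: card_ge0.
have next (g : mu -> W) i : exists w, C w /\ forall j, lt j i -> (g j < w)%O.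
  have [|w wP] := succ_bound kappa_inf Wsucc g (A := [set j | lt j i]).
    by apply: card_le_trans mu_card; exact: card_leT.
  have [w' [_ Cw' ww']] := Cunb w I.
  by exists w'; split => // j /wP/lt_trans; apply.
pose F (g : mu -> W) i := xget w0 [set w | C w /\ forall j, lt j i -> (g j < w)%O].
have [|g gP] := @wf_recursion mu W w0 lt F wf.
  move=> i f g fg; rewrite /F; congr xget; apply/seteqP; split => w [Cw H].
    by split => // j ji; rewrite -fg//; exact: H.
  by split => // j ji; rewrite fg//; exact: H.
have {}gP i : C (g i) /\ forall j, lt j i -> (g j < g i)%O.
  by rewrite gP; exact: (@xgetPex _ w0
    [set w | C w /\ forall j, lt j i -> (g j < w)%O] (next g i)).
have [s [gs sP]] := succ_lub g mu_card.
have gls i : (g i < s)%O.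
  have [j ij] := mu_nomax i; apply: lt_le_trans (gs j I); exact: (gP j).2.
have gl : ladder lt s g.
  split => // [i j ij|x /sP[i [_ xi]]]; first exact: (gP j).2.
  by exists i.
exists s; split; first by exists g.
apply: Ccl => //; first exact: ladder_limit gl.
by move=> x /sP[i [_ xi]]; exists (g i); split; [exact: gls|exact: (gP i).1|].
Qed.

End Clubs.

(** * Gluing along a ladder system *)

Section Assembly.
Variables (S : pzRingType) (mu : choiceType) (lt : mu -> mu -> Prop).
Hypothesis mu_wo : strict_wo lt.
Variables (N : lmodType S) (e : mu -> {linear N -> N}).
Hypothesis e_idem : forall i v, e i (e i v) = e i v.
Hypothesis e_coord : forall f, exists q : {linear N -> dsum mu N},
  forall k, lt k f -> forall v, q (e k v) = dsum_in k (e k v).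
Variables (d : Order.disp_t) (W : orderType d) (eta : W -> mu -> W).

(* The module glued from copies [N_delta] (index [(delta, None)]) and points
   (index [(beta, Some i)]), where [e i v] in [N_delta] is identified with [e i v]
   at the point [(eta delta i, Some i)] for each [delta] in [A]; a homomorphism
   from it is a [compatible] family. *)
Definition compatible (A : set W) (T : lmodType S)
    (rho : W * option mu -> {linear N -> T}) :=
  forall delta, A delta -> forall i v,
    rho (delta, None) (e i v) = rho (eta delta i, Some i) (e i v).

(* On a disjointified set, the values on the tail of each ladder can be dictated
   by [N_delta]; the value on [N_delta] only has to be corrected along its
   coordinates below [f delta], whence the recursion on [f delta]. *)
Lemma compatible_lift (A : set W) (f : W -> mu) (Q0 : W -> mu -> Prop)
    (T T' : lmodType S) (p : {linear T -> T'})
    (rho' : W * option mu -> {linear N -> T'})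
    (rho1 : W * option mu -> {linear N -> T}) :
    disjointifies lt eta A f ->
    (forall delta i, A delta -> Q0 (eta delta i) i -> lt i (f delta)) ->
    compatible A rho' -> (forall k v, p (rho1 k v) = rho' k v) ->
  exists rho, [/\ compatible A rho, forall k v, p (rho k v) = rho' k v,
    forall b i, Q0 b i -> rho (b, Some i) = rho1 (b, Some i) &
    forall delta, ~ A delta -> rho (delta, None) = rho1 (delta, None)].
Proof.
move=> fdisj fQ0 rho'C rho1P; have [wf tr tot] := mu_wo.
have [q qP] := choice e_coord.
pose Hom := {linear N -> T}.
pose lift (r : mu -> Hom) := sval (cid (dsum_lift r)).
have liftP r i v : lift r (dsum_in i v) = r i v.
  by rewrite /lift; case: cid.
(* By disjointness at most one ladder has its tail through the point [(b, i)]. Unless [Q0] fixes the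
   point, [pt] changes the value there on the image of [e i] to agree with the copy of [N] belonging
   to that ladder. *)
pose tailof b i := [set x | [/\ A x, eta x i = b & ~ lt i (f x)]].
pose pt (g : mu -> W -> Hom) b i : Hom :=
  if pselect (~ Q0 b i /\ tailof b i !=set0) is left _ then
    let x := xget b (tailof b i) in
    rho1 (b, Some i) \+ ((g (f x) x \- rho1 (b, Some i)) \o e i)
  else rho1 (b, Some i).
(* Below [t] the point decides instead, and [corr] replaces the coordinate of [rho1] by the value at
   the point. That value may come from the tail of another ladder, whose [f] is at most [i] and so
   below [t]. *)
pose corr (g : mu -> W -> Hom) t x i : Hom :=
  if pselect (lt i t) is left _ then
    (pt g (eta x i) i \- rho1 (x, None)) \o e i
  else \0.
pose F (g : mu -> W -> Hom) t : W -> Hom :=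
  fun x => rho1 (x, None) \+ (lift (corr g t x) \o q t).
have [|g gP] := @wf_recursion mu (W -> Hom) (fun=> \0) lt F wf.
  move=> t g h gh; apply/funext => x; rewrite /F.
  suff -> : corr g t x = corr h t x by [].
  apply/funext => i; rewrite /corr; case: pselect => // it.
  suff -> : pt g (eta x i) i = pt h (eta x i) i by [].
  rewrite /pt; case: pselect => // -[_ tl0] /=.
  have [_ _ nlt] : tailof (eta x i) i (xget (eta x i) (tailof (eta x i) i)).
    exact: xgetPex.
  rewrite gh//; case: (tot (f (xget (eta x i) (tailof (eta x i) i))) i) => [fi|->//|//].
  exact: tr it.
pose rho (k : W * option mu) : Hom :=
  if k.2 is Some i then pt g k.1 i
  else if pselect (A k.1) is left _ then g (f k.1) k.1 else rho1 k.
have rhoN x : A x -> rho (x, None) = g (f x) x by rewrite /rho /=; case: pselect.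
have gE x v : g (f x) x v = rho1 (x, None) v + lift (corr g (f x) x) (q (f x) v).
  by rewrite gP.
have rhoC : compatible A rho.
  move=> x Ax i v; rewrite rhoN//.
  have [ifx|nifx] := pselect (lt i (f x)).
    rewrite gE qP// liftP /corr; case: pselect => // _ /=.
    by rewrite e_idem addrC subrK.
  rewrite /rho /= /pt; case: pselect => [[_ tl]|n] /=; last first.
    by case: n; split; [move/(fQ0 _ _ Ax)|exists x].
  have [Ay xy niy] : tailof (eta x i) i (xget (eta x i) (tailof (eta x i) i)).
    exact: xgetPex.
  have <- : x = xget (eta x i) (tailof (eta x i) i).
    by apply: contrapT => nxy; have [] := fdisj x _ Ax Ay nxy i (esym xy).
  by rewrite e_idem addrC subrK.
(* Applying [p] kills every correction, since [rho'] is already compatible. *)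
have pg t : forall x v, A x -> f x = t -> p (g t x v) = rho' (x, None) v.
  elim/(well_founded_ind wf): t => t IH x v Ax fx.
  rewrite -fx gE linearD rho1P -[RHS]addr0; congr (_ + _).
  move: (q (f x) v) => y.
  apply: (@dsum_linear_ext _ _ _ _ (p \o lift (corr g (f x) x) : {linear _ -> _}) \0) => i u /=.
  rewrite liftP /corr; case: pselect => [ifx|_] /=; last by rewrite linear0.
  rewrite linearB rho1P (rho'C x Ax).
  rewrite /pt; case: pselect => [[_ tl]|n] /=; last by rewrite rho1P subrr.
  have [Ay xy niy] : tailof (eta x i) i (xget (eta x i) (tailof (eta x i) i)).
    exact: xgetPex.
  move: (xget _ _) Ay xy niy => y' Ay xy niy.
  rewrite e_idem linearD linearB rho1P (IH (f y'))// ?(rho'C y' Ay) ?xy.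
    by rewrite subrr addr0 subrr.
  by rewrite -fx; case: (tot (f y') i) => [fi|->//|//]; exact: tr ifx.
exists rho; split => //.
- case=> b [i|] v; last first.
    by rewrite /rho /=; case: pselect => // Ab; exact: pg.
  rewrite /rho /= /pt; case: pselect => [[_ tl]|_] /=; last exact: rho1P.
  have [Ay xy niy] : tailof b i (xget b (tailof b i)) by exact: xgetPex.
  move: (xget _ _) Ay xy niy => y Ay xy niy.
  by rewrite linearD linearB !rho1P (pg (f y))// (rho'C y Ay) xy subrr addr0.
- by move=> b i Qbi; rewrite /rho /= /pt; case: pselect => // -[].
- by move=> x nAx; rewrite /rho /=; case: pselect.
Qed.

End Assembly.

Section Glue.
Variables (S : pzRingType) (mu : choiceType) (lt : mu -> mu -> Prop).
Hypotheses (mu_wo : strict_wo lt) (mu0 : inhabited mu).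
Variables (N : lmodType S) (e : mu -> {linear N -> N}).
Hypothesis e_idem : forall i v, e i (e i v) = e i v.
Hypothesis e_coord : forall f, exists q : {linear N -> dsum mu N},
  forall k, lt k f -> forall v, q (e k v) = dsum_in k (e k v).
Variables (d : Order.disp_t) (W : orderType d) (E : set W) (eta : W -> mu -> W).
Hypotheses (Wnomax : forall a : W, exists w, (a < w)%O)
  (Eladder : forall delta, E delta -> ladder lt delta (eta delta))
  (Edisj : forall a, exists f, disjointifies lt eta (E `&` below a) f).

Let G := dsum (W * option mu)%type N.

Definition glue_at k : {linear N -> G} := @dsum_in S (W * option mu)%type N k.
Definition glue_trunc (A : set W) : {linear G -> G} := dsum_restrict [set k | A k.1].
Definition below_eq (a : W) : set W := [set x | (x <= a)%O].
Definition supported (A : set W) (g : G) := forall k, g k <> 0 -> A k.1.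

Lemma glue_trunc_supported A g : supported A (glue_trunc A g).
Proof. by move=> k; rewrite dsum_restrictE; case: asboolP. Qed.

Lemma glue_trunc_id A g : supported A g -> glue_trunc A g = g.
Proof. by move=> gA; apply: dsum_restrict_id => k /gA. Qed.

Lemma glue_trunc_at (A : set W) k v : A k.1 -> glue_trunc A (glue_at k v) = glue_at k v.
Proof. exact: dsum_restrict_in. Qed.

Lemma supported_sub (A B : set W) : A `<=` B -> supported A `<=` supported B.
Proof. by move=> AB g gA k /gA/AB. Qed.

Lemma supported_bound (A : set W) g : (exists a, A a) -> supported A g ->
  exists2 a, A a & supported (below_eq a) g.
Proof.
move=> [a0 Aa0] gA; have [s _ sg] := dsum_supp g.
have [a Aa as_] : exists2 a, A a & forall k, k \in s -> A k.1 -> (k.1 <= a)%O.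
  elim: s {sg} => [|k s [a Aa IH]]; first by exists a0.
  have [Ak|nAk] := pselect (A k.1); last first.
    exists a => // k'; rewrite inE => /orP[/eqP->//|]; exact: IH.
  have [ka|ak] := leP k.1 a.
    by exists a => // k'; rewrite inE => /orP[/eqP->//|]; exact: IH.
  exists k.1 => // k'; rewrite inE => /orP[/eqP->//|k's Ak'].
  exact: le_trans (IH _ k's Ak') (ltW ak).
by exists a => // k gk; apply: as_; [exact: sg|exact: gA].
Qed.

Definition linear_compatible (A : set W) (T : lmodType S) (u : {linear G -> T}) :=
  forall delta, A delta -> forall i v,
    u (glue_at (delta, None) (e i v)) = u (glue_at (eta delta i, Some i) (e i v)).

(** Span of the identifications, given through its universal property as a common kernel. The bound
    [b] confines each relation to ladders that can be disjointified together. *)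
Definition glue_relations : set G := [set g | exists b, forall (T : lmodType S)
  (u : {linear G -> T}), linear_compatible (E `&` below b) u -> u g = 0].

Lemma glue_relations_submodule (w0 : W) : submodule glue_relations.
Proof.
apply: submodule_intro => [|a x y [b1 H1] [b2 H2]].
  by exists w0 => T u _; exact: linear0.
exists (Order.max b1 b2) => T u uC.
rewrite linearP H1 ?H2 ?scaler0 ?addr0// => delta [Ed db]; apply: uC; split => //;
  by apply: (lt_le_trans db); rewrite le_max lexx ?orbT.
Qed.

(** [u], kept at the places up to [a], is completed to a map compatible with all ladders of [E]
    below [b]: the ladder of a point beyond [a] has a tail outside these places, where values can be
    chosen. *)
Lemma linear_compatible_relations a (T : lmodType S) (u : {linear G -> T}) :
  linear_compatible (E `&` below_eq a) u ->
  forall g, glue_relations g -> supported (below_eq a) g -> u g = 0.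
Proof.
move=> uC g [b gb] ga.
have [f fdisj] := Edisj b.
have /choice[h hP] : forall x, exists i, E x -> (a < x)%O -> (a < eta x i)%O.
  move=> x; have [[Ex ax]|n] := pselect (E x /\ (a < x)%O).
    by have [_ _ /(_ _ ax)[i]] := Eladder Ex; exists i.
  by have [i] := mu0; exists i => Ex ax; case: n.
have /choice[f' f'P] : forall x, exists m, forall i, lt i (f x) \/ lt i (h x) -> lt i m.
  by move=> x; exact: wo_max2.
pose A := [set x | [/\ E x, (a < x)%O & (x < b)%O]].
(* With the zero map as [p] the lifting condition is void, and [compatible_lift] serves as an
   extension result. *)
have [|delta i [Ed ad db] /= ea|||rho [rhoC _ rhoQ rhoA]] :=
  @compatible_lift S mu lt mu_wo N e e_idem e_coord d W eta A f'
    (fun b _ => (b <= a)%O) T T \0 (fun=> \0)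
    (fun k => u \o glue_at k : {linear _ -> _}).
- move=> x y [Ex _ xb] [Ey _ yb] xy i exy.
  by have [] := fdisj x y (conj Ex xb) (conj Ey yb) xy i exy => H; [left|right];
    apply: f'P; left.
- apply: f'P; right; apply: (ladder_lt mu_wo (Eladder Ed)).
  exact: le_lt_trans ea (hP _ Ed ad).
- by [].
- by [].
have [u' u'P] := dsum_lift rho.
have u'u g' : supported (below_eq a) g' -> u' g' = u g'.
  move=> g'a; apply: (@dsum_submodule_ind _ _ _ [set g' | u' g' = u g']) => [|k /g'a ka v /=].
    apply: submodule_intro => [|c x y /= ux uy]; first by rewrite /= !linear0.
    by rewrite !linearP ux uy.
  rewrite u'P; case: k ka => c [i|] /= ca; first by rewrite rhoQ.
  by rewrite rhoA// => -[_ /(le_lt_trans ca)]; rewrite ltxx.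
rewrite -u'u//; apply: gb => delta [Ed db] i v; rewrite /glue_at !u'P.
have [da|ad] := leP delta a; last by rewrite rhoC.
have [_ /(_ i) ed _] := Eladder Ed.
rewrite rhoA ?rhoQ/=; last 2 first.
- by apply: ltW; exact: lt_le_trans da.
- by move=> [_ /(le_lt_trans da)]; rewrite ltxx.
exact: uC.
Qed.

Variables (X : lmodType S) (p : {linear G -> X}).
Hypothesis p_ker : forall g, p g = 0 <-> glue_relations g.

Lemma glue_compatible A : A `<=` E -> linear_compatible A p.
Proof.
move=> AE delta /AE Ed i v; apply/eqP; rewrite -subr_eq0 -linearB; apply/eqP/p_ker.
have [b db] := Wnomax delta; exists b => T u uC.
by rewrite linearB uC ?subrr.
Qed.

Definition glue_part (A : set W) : set X := range (p \o glue_trunc A).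

Lemma glue_partP A x : glue_part A x <-> exists2 g, supported A g & p g = x.
Proof.
split=> [[g _ <-]|[g gA <-]].
  by exists (glue_trunc A g) => //; exact: glue_trunc_supported.
by exists g => //=; rewrite glue_trunc_id.
Qed.

Lemma glue_part_submodule A : submodule (glue_part A).
Proof. exact: submodule_range. Qed.

Lemma glue_part_sub (A B : set W) : A `<=` B -> glue_part A `<=` glue_part B.
Proof.
by move=> AB x /glue_partP[g gA <-]; apply/glue_partP; exists g => //; exact: supported_sub gA.
Qed.

(** Lifting the generators along the surjection [pa] to a compatible family in [G] gives a section
    of [pa]. It is well defined on [U] because relations up to [a] come from ladders up to [a]. *)
Lemma glue_part_retract a (U : lmodType S) (j : {linear U -> X}) :
  injective j -> range j = glue_part (below_eq a) -> retract U G.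
Proof.
move=> jinj jrange.
have [pa paP] : exists pa : {linear G -> U}, forall g, j (pa g) = p (glue_trunc (below_eq a) g).
  apply: (linear_corestrict (f := p \o glue_trunc (below_eq a) : {linear _ -> _}) jinj) => g.
  have : range j (p (glue_trunc (below_eq a) g)) by rewrite jrange; exists g.
  by case=> y _ yg; exists y.
have pasurj y : exists g, pa g = y.
  have : range j (j y) by exists y.
  by rewrite jrange => -[g _ gy]; exists g; apply: jinj; rewrite paP.
have [w aw] := Wnomax a.
have [f fdisj] := Edisj w.
have [|//|delta [Ed da] i v|//|rho [rhoC rhoP _ _]] :=
  @compatible_lift S mu lt mu_wo N e e_idem e_coord d W eta (E `&` below_eq a) f
    (fun _ _ => False) G U pa (fun k => pa \o glue_at k : {linear _ -> _}) glue_at.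
- move=> x y [Ex xa] [Ey ya]; apply: fdisj; split => //; exact: le_lt_trans aw.
- apply: jinj; rewrite /= !paP !glue_trunc_at//=; first exact: (glue_compatible (A := E)).
  by have [_ ed _] := Eladder Ed; apply: ltW; exact: lt_le_trans da.
have [u uP] := dsum_lift rho.
have uC : linear_compatible (E `&` below_eq a) u.
  by move=> delta Ad i v; rewrite /glue_at !uP; exact: rhoC.
have pau g : pa (u g) = pa g.
  apply: (@dsum_linear_ext _ _ _ _ (pa \o u : {linear _ -> _}) pa) => k v.
  by rewrite /= uP rhoP.
have [|s sP] := linear_factor (u := u \o glue_trunc (below_eq a) : {linear _ -> _}) pasurj.
  move=> g pag0 /=; apply: (linear_compatible_relations uC); last exact: glue_trunc_supported.
  by apply/p_ker; rewrite -paP pag0 linear0.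
exists s, pa => y; have [g <-] := pasurj y; rewrite sP /= pau.
apply: jinj; rewrite !paP; congr (p _).
exact: glue_trunc_id (@glue_trunc_supported _ _).
Qed.

(* The ladder of [delta] can be put first when gluing, so the part below [delta]
   retracts onto the direct sum of the modules [e i N] sitting on it. *)
Lemma glue_ladder_retraction delta (U : lmodType S) (j : {linear U -> X}) :
  E delta -> injective j -> range j = glue_part (below delta) ->
  exists t : {linear U -> dsum mu N}, forall y i v,
    j y = p (glue_at (eta delta i, Some i) v) -> t y = dsum_in i v.
Proof.
move=> Ed jinj jrange.
have [pa paP] : exists pa : {linear G -> U}, forall g, j (pa g) = p (glue_trunc (below delta) g).
  apply: (linear_corestrict (f := p \o glue_trunc (below delta) : {linear _ -> _}) jinj) => g.
  have : range j (p (glue_trunc (below delta) g)) by rewrite jrange; exists g.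
  by case=> y _ yg; exists y.
have pasurj y : exists g, pa g = y.
  have : range j (j y) by exists y.
  by rewrite jrange => -[g _ gy]; exists g; apply: jinj; rewrite paP.
have [f fdisj] := Edisj delta.
have Edl := Eladder Ed; have [_ ed_lt ed_cof] := Edl.
(* From [h x] on, the ladder of [delta] lies above [x], so the ladder of [x] shares a point with it
   only at indices below [h x]. This lets the values on the ladder of [delta] be prescribed. *)
have /choice[h hP] : forall x, exists i, (x < delta)%O -> (x < eta delta i)%O.
  move=> x; have [/ed_cof[i xi]|n] := pselect (x < delta)%O; first by exists i.
  by have [i] := mu0; exists i.
have /choice[f' f'P] : forall x, exists m, forall i, lt i (f x) \/ lt i (h x) -> lt i m.
  by move=> x; exact: wo_max2.
have [|x i [Ex xd] /= xdi|//|//|rho [rhoC _ rhoQ _]] :=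
  @compatible_lift S mu lt mu_wo N e e_idem e_coord d W eta (E `&` below delta) f'
    (fun b i => b = eta delta i) (dsum mu N) (dsum mu N) \0 (fun=> \0)
    (fun k => if k.2 is Some i then dsum_in i : {linear _ -> _} else \0).
- move=> x y Ax Ay xy i exy.
  by have [] := fdisj x y Ax Ay xy i exy => H; [left|right]; apply: f'P; left.
- apply: f'P; right; apply: (ladder_lt mu_wo Edl); rewrite -xdi.
  have [_ ex_lt _] := Eladder Ex.
  exact: lt_trans (ex_lt i) (hP _ xd).
have [u uP] := dsum_lift rho.
have delta0 : exists a, below delta a by have [i] := mu0; exists (eta delta i); exact: ed_lt.
have [|t tP] := linear_factor (u := u \o glue_trunc (below delta) : {linear _ -> _}) pasurj.
  move=> g pag0 /=.
  (* By finite support the element lives on places up to some [a] below [delta], where the relations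
     are controlled. *)
  have [a ad ga] := supported_bound delta0 (@glue_trunc_supported (below delta) g).
  apply: (@linear_compatible_relations a) => //; last first.
    by apply/p_ker; rewrite -paP pag0 linear0.
  move=> x [Ex xa] i v; rewrite /glue_at !uP; apply: rhoC; split => //.
  exact: le_lt_trans ad.
exists t => y i v jy.
have -> : y = pa (glue_at (eta delta i, Some i) v).
  by apply: jinj; rewrite paP glue_trunc_at//; exact: ed_lt.
rewrite tP /= glue_trunc_at ?uP; last exact: ed_lt.
by rewrite rhoQ.
Qed.

End Glue.

(** * Covers of large directed unions *)

Section DirectedUnionLimit.
Variables (S : pzRingType) (X : lmodType S).
Variables (d : Order.disp_t) (W : orderType d) (P : W -> set X).
Hypotheses (W0 : inhabited W) (Psub : forall a, submodule (P a))
  (Pmono : forall a b, (a <= b)%O -> P a `<=` P b) (Pcover : forall x, exists a, P a x).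

Lemma directed_union_in_lim (C : lmodType S -> Prop) :
  (forall a (U : lmodType S) (j : {linear U -> X}),
    injective j -> range j = P a -> C U) -> in_lim C X.
Proof.
move=> CP.
have [U [j [jinj jrange]]] : exists (U : W -> lmodType S) (j : forall a, {linear U a -> X}),
    (forall a, injective (j a)) /\ (forall a, range (j a) = P a).
  exists (fun a => submod (Psub a)), (fun a => val : {linear submod (Psub a) -> X}).
  split=> a; first exact: val_inj.
  apply/seteqP; split => [_ [x _ <-]|x Px]; first exact: set_mem (submod_valP x).
  by exists (Submod (mem_set Px : x \in submod_pred (Psub a))).
have jin a x : P a (j a x) by rewrite -jrange; exists x.
have jex a x : P a x -> exists y, j a y = x by rewrite -jrange => -[y _ <-]; exists y.
have inc a b (ab : (a <= b)%O) : exists t : {linear U a -> U b}, forall x, j b (t x) = j a x.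
  by apply: linear_corestrict => // x; apply: jex; exact: Pmono ab _ _.
pose f a b ab := sval (cid (inc a b ab)).
have fP a b ab x : j b (f a b ab x) = j a x by rewrite /f; case: cid.
have dir (a b : W) : exists k, ((a <= k)%O && (b <= k)%O).
  by exists (Order.max a b); rewrite !le_max !lexx orbT.
have fid a aa x : f a a aa x = x by apply: jinj; rewrite fP.
have fcomp a b c (ab : (a <= b)%O) (bc : (b <= c)%O) (ac : (a <= c)%O) :
    f b c bc \o f a b ab =1 f a c ac.
  by move=> x; apply: jinj; rewrite /= !fP.
pose F := @DirectedSystem S _ W U f W0 dir fid fcomp.
exists d, W, F, j; split; first by move=> a; exact: CP (@jinj a) (jrange a).
split; first by move=> a b ab x /=; rewrite fP.
move=> N h hC.
have hE a b x y : j a x = j b y -> h a x = h b y.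
  wlog ab : a b x y / (a <= b)%O.
    move=> H xy; have [ab|/ltW ba] := leP a b; first exact: H.
    by apply/esym/H.
  move=> xy; have <- : f a b ab x = y by apply: jinj; rewrite fP.
  exact/esym/hC.
have [x|y [a [x [jx <-]]]|c x y x' y' [a [z [<- <-]]] [b [z' [<- <-]]]|u uP] :=
  @linear_of_relation S X N (fun x y => exists a z, j a z = x /\ h a z = y).
- by have [a /jex[z zx]] := Pcover x; exists (h a z), a, z.
- by have -> : x = 0; [apply: jinj; rewrite jx linear0|exact: linear0].
- have [k /andP[ak bk]] := dir a b.
  exists k, (c *: f a k ak z + f b k bk z'); split.
    by rewrite linearP !fP.
  by rewrite linearP; congr (_ *: _ + _); apply: hE; rewrite fP.
have uj a z : u (j a z) = h a z.
  by have [b [z' [jz <-]]] := uP (j a z); exact: hE.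
exists u; split => // v vP x; have [a /jex[z <-]] := Pcover x.
by rewrite uj -vP.
Qed.

End DirectedUnionLimit.

Section LargeUnion.
Variables (S : pzRingType) (M X : lmodType S).
Variables (kappa : choiceType) (d : Order.disp_t) (W : orderType d) (P : W -> set X).
Hypotheses (kappa_inf : infinite_set [set: kappa])
  (Wsucc : successor_cardinal kappa W) (Mk : [set: M] #<= [set: kappa]).
Hypotheses (W0 : inhabited W) (Psub : forall a, submodule (P a))
  (Pmono : forall a b, (a <= b)%O -> P a `<=` P b) (Pcover : forall x, exists a, P a x).

(** For each [z] the at most [kappa] values lie in one [P a] by regularity; for finitely many [z] a
    maximum is taken. *)
Lemma finite_sum_image_bounded (Z : choiceType) (f : {linear dsum Z M -> X}) (s : seq Z) :
  exists a, forall z, z \in s -> forall m, P a (f (dsum_in z m)).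
Proof.
elim: s => [|z s [a IH]]; first by have [a] := W0; exists a.
have /choice[h hP] := fun m => Pcover (f (dsum_in z m)).
have [b hb] := succ_bound kappa_inf Wsucc h Mk.
exists (Order.max a b) => z'; rewrite inE => /orP[/eqP->|z's] m.
  by apply: (Pmono _ (hP m)); rewrite le_max (ltW (hb m I)) orbT.
by apply: (Pmono _ (IH _ z's m)); rewrite le_max lexx.
Qed.

Hypothesis PAdd : forall a (U : lmodType S) (j : {linear U -> X}),
  injective j -> range j = P a -> in_Add M U.

(* If [x] is in the kernel of a cover [f : C -> X], a finite subsum [M^F] carrying
   [x] is mapped into some [P a] in [Add M], so [f] restricted to it lifts through
   [P a] by a map killing [x]; splicing the lift into the identity of [C] gives an
   endomorphism over [f], hence an automorphism. *)
Lemma cover_of_large_union : has_cover (in_Add M) X -> in_Add M X.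
Proof.
have Utype a : exists (U : lmodType S) (j : {linear U -> X}), injective j /\ range j = P a.
  exact: submodule_type.
move=> [C [f [[CAdd fpre] fcov]]].
have /in_AddP[Z [ic [pc icK]]] := CAdd.
have finj x : f x = 0 -> x = 0.
  move=> fx; have [s _ sx] := dsum_supp (ic x).
  pose chi : {linear dsum Z M -> dsum Z M} := dsum_restrict [set z | z \in s].
  have [a aP] := finite_sum_image_bounded (f \o pc : {linear _ -> _}) s.
  have [U [j [jinj jrange]]] := Utype a.
  have [phi phiP] : exists phi : {linear C -> U}, forall c, j (phi c) = f (pc (chi (ic c))).
    apply: (linear_corestrict (f := f \o pc \o chi \o ic : {linear _ -> _}) jinj) => c.
    have : P a (f (pc (chi (ic c)))).
      apply: (@dsum_submodule_ind _ _ _ [set y | P a (f (pc y))]) => [|z + m].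
        apply: submodule_intro => [|b y y' Py Py' /=].
          by rewrite /= !linear0; exact: submodule0.
        by rewrite !linearP; exact: submoduleP.
      rewrite dsum_restrictE; case: asboolP => // zs _; exact: aP.
    by rewrite -jrange => -[y _ yE]; exists y.
  have [l lP] := fpre U (PAdd jinj jrange) j.
  pose g : {linear C -> C} := (l \o phi) \+ (pc \o (ic \- (chi \o ic))).
  have fg : f \o g =1 f.
    move=> c; rewrite /= linearD !linearB /= icK.
    have /= -> := lP (phi c).
    by rewrite phiP addrC subrK.
  have /bij_inj ginj := fcov g fg.
  apply: ginj; rewrite linear0 /g /=.
  have -> : chi (ic x) = ic x by apply: dsum_restrict_id.
  rewrite subrr linear0 addr0.
  have -> : phi x = 0; last by rewrite linear0.
  apply: jinj; rewrite phiP linear0.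
  have -> : chi (ic x) = ic x by apply: dsum_restrict_id.
  by rewrite icK.
(* The inclusions of the parts [P a] factor through the precover, and the parts exhaust [X]. *)
have fsurj x : exists c, f c = x.
  have [a Pax] := Pcover x; have [U [j [jinj jrange]]] := Utype a.
  have [l lP] := fpre U (PAdd jinj jrange) j.
  move: Pax; rewrite -jrange => -[y _ <-]; exists (l y); exact: lP.
have [|t tP] := linear_factor (u := idfun : {linear C -> C}) fsurj; first exact: finj.
apply: in_Add_retract CAdd; exists t, f => x.
by have [c <-] := fsurj x; rewrite tP.
Qed.

End LargeUnion.

(** * Closing off in the glued module *)

Section ExtendCoordinates.
Hypothesis star : proper_class_of_cardinals has_nonreflecting_subsets.
Variables (S : pzRingType) (M : lmodType S).
Hypothesis covers : forall L : lmodType S, in_lim (in_Add M) L -> has_cover (in_Add M) L.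
Variables (N : lmodType S) (mu : choiceType) (lt : mu -> mu -> Prop).
Hypotheses (NAdd : in_Add M N) (mu_wo : strict_wo lt) (mu0 : inhabited mu)
  (mu_nomax : forall i, exists j, lt i j).
Variable e : mu -> {linear N -> N}.
Hypothesis e_idem : forall i v, e i (e i v) = e i v.
Hypothesis e_coord : forall f, exists q : {linear N -> dsum mu N},
  forall k, lt k f -> forall v, q (e k v) = dsum_in k (e k v).

(** The hypothesis supplies coordinates only for the indices below each [f]; here one map serves all
    indices. It is the composite of [N_delta] into [X], the projection onto the part below a
    suitable [delta], and the retraction onto its ladder. *)
Lemma coordinates_extend : exists q : {linear N -> dsum mu N},
  forall k v, q (e k v) = dsum_in k (e k v).
Proof.
have [kappa [[kinf [d [W [Wsucc Wnr]]]] Uk]] :=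
  large_nonreflecting_cardinal star (option mu + (N + M))%type.
have muk : [set: option mu] #<= [set: kappa].
  by apply: card_le_trans Uk; apply: (@card_leT_inj _ _ inl) => x y [].
have mk : [set: mu] #<= [set: kappa].
  by apply: card_le_trans muk; apply: (@card_leT_inj _ _ Some) => x y [].
have Nk : [set: N] #<= [set: kappa].
  by apply: card_le_trans Uk; apply: (@card_leT_inj _ _ (inr \o inl)) => x y [].
have Mk : [set: M] #<= [set: kappa].
  by apply: card_le_trans Uk; apply: (@card_leT_inj _ _ (inr \o inr)) => x y [].
have [E [EE Est Enr]] := Wnr _ (stationary_ladders kinf Wsucc mu_wo mu0 mu_nomax mk).
have Wwo : strict_wo (fun x y : W => (x < y)%O).
  by have [wo _ _] := Wsucc; exact: strict_wo_lt.
have Wnomax := succ_bound1 kinf Wsucc.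
have W0 : inhabited W.
  by have [w _] := Est.2 _ (club_closed_under kinf Wsucc id); exact: (inhabits w).
have [w0] := W0.
have /choice[eta etaP] : forall x, exists eta, E x -> ladder lt x eta.
  move=> x; have [/EE[eta ?]|n] := pselect (E x); first by exists eta.
  by exists (fun=> w0) => /n.
have Edisj := ladders_disjointifiable Wwo mu_wo mu0 etaP Enr.
have [X [p [psurj pker]]] := quotient_type
  (glue_relations_submodule e E eta w0).
pose P a := glue_part p (below_eq a).
have Psub a : submodule (P a) by exact: glue_part_submodule.
have Pmono a b : (a <= b)%O -> P a `<=` P b.
  by move=> ab; apply: glue_part_sub => x /le_trans; apply.
have Pcover x : exists a, P a x.
  have [g <-] := psurj x.
  have [|a _ ga] := @supported_bound _ _ _ _ _ setT g _ (fun _ _ => I); first by exists w0.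
  by exists a; apply/glue_partP; exists g.
have PAdd a (U : lmodType S) (j : {linear U -> X}) :
    injective j -> range j = P a -> in_Add M U.
  move=> jinj jr; apply: in_Add_retract (in_Add_dsum _ NAdd).
  exact: (glue_part_retract mu_wo mu0 e_idem e_coord Wnomax etaP Edisj pker jinj jr).
have XAdd : in_Add M X.
  apply: (cover_of_large_union kinf Wsucc Mk W0 Psub Pmono Pcover PAdd).
  by apply: covers; exact: directed_union_in_lim Pmono Pcover _ PAdd.
have /in_AddP[Z [iX [pX iXK]]] := XAdd.
(* [b k v] bounds the images in [X] of the copies of [M] met by the generator [v] at [k]. Then [h a]
   bounds [b] over the at most [kappa] generators placed up to [a]. *)
have /choice[b bP] : forall k : W * option mu, exists b : N -> W,
    forall v z, iX (p (glue_at N k v)) z <> 0 -> forall m, P (b v) (pX (dsum_in z m)).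
  move=> k; suff /choice[b bP] : forall v, exists w,
    forall z, iX (p (glue_at N k v)) z <> 0 -> forall m, P w (pX (dsum_in z m)) by exists b.
  move=> v; have [s _ sP] := dsum_supp (iX (p (glue_at N k v))).
  have [a aP] := finite_sum_image_bounded kinf Wsucc Mk W0 Pmono Pcover pX s.
  by exists a => z /sP; exact: aP.
have /choice[h hP] : forall a, exists w, forall k v, (k.1 <= a)%O -> (b k v <= w)%O.
  move=> a.
  have /choice[b1 b1P] : forall k, exists w, forall v, (b k v < w)%O.
    by move=> k; have [w wP] := succ_bound kinf Wsucc (b k) Nk; exists w => v; exact: wP.
  have /choice[b2 b2P] : forall x, exists w, forall o, (b1 (x, o) < w)%O.
    move=> x; have [w wP] := succ_bound kinf Wsucc (fun o => b1 (x, o)) muk.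
    by exists w => o; exact: wP.
  have [w wP] := succ_bound kinf Wsucc b2 (succ_le_card kinf Wsucc a).
  exists w => -[x o] v /= xa.
  exact: ltW (lt_trans (b1P _ v) (lt_trans (b2P _ _) (wP _ xa))).
have [delta [Ed [dlim dh]]] := Est.2 _ (club_closed_under kinf Wsucc h).
have ed := etaP _ Ed; have [_ ed_lt _] := ed.
pose D := glue_part p (below delta).
have Dsub : submodule D by exact: glue_part_submodule.
(* The copies of [M] met by generators below [delta] are sent by [pX] back below [delta], as [delta]
   is closed under [h]. Restricting to them yields a projection of [X] onto [D]. *)
pose Zd := [set z | exists k v, (k.1 < delta)%O /\ iX (p (glue_at N k v)) z <> 0].
have [rho rhoE] : exists rho : {linear X -> X},
    forall x, rho x = pX (dsum_restrict Zd (iX x)).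
  by exists (pX \o dsum_restrict Zd \o iX : {linear _ -> _}).
have rhoD x : D (rho x).
  rewrite rhoE.
  apply: (@dsum_submodule_ind _ _ _ [set y | D (pX y)]) => [|z + m].
    apply: submodule_intro => [|c y y' Py Py' /=].
      by rewrite /= !linear0; exact: submodule0.
    by rewrite !linearP; exact: submoduleP.
  rewrite dsum_restrictE; case: asboolP => // -[k [v [kd zk]]] _ /=.
  apply: (@glue_part_sub _ _ _ _ _ _ _ (below_eq (h k.1))).
    by move=> x' /le_lt_trans; apply; exact: dh.
  by apply: Pmono (bP k v z zk m); exact: hP.
have rho_id x : D x -> rho x = x.
  move=> /glue_partP[g gd <-].
  apply: (@dsum_submodule_ind _ _ _ [set g | rho (p g) = p g]) => [|k /gd kd v].
    apply: submodule_intro => [|c y y' Py Py' /=]; first by rewrite /= !linear0.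
    by rewrite !linearP Py Py'.
  rewrite /= rhoE dsum_restrict_id ?iXK// => z zk.
  by exists k, v.
have [U [j [jinj jrange]]] := submodule_type Dsub.
have [r rP] : exists r : {linear X -> U}, forall x, j (r x) = rho x.
  apply: linear_corestrict => // x; have := rhoD x; rewrite -jrange => -[y _ yE].
  by exists y.
have [t tP] := glue_ladder_retraction mu_wo mu0 e_idem e_coord etaP Edisj pker Ed jinj jrange.
exists (t \o (r \o (p \o @glue_at S mu N d W (delta, None))) : {linear _ -> _}) => k v /=.
apply: (tP _ _ (e k v)); rewrite rP.
(* The relation at [delta] moves [e k v] to its point on the ladder, an element of [D], which [rho]
   fixes. *)
rewrite (glue_compatible Wnomax pker (A := E))// rho_id//.
apply/glue_partP; exists (glue_at N (eta delta k, Some k) (e k v)) => // k'.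
by rewrite dsum_inE; case: eqP => // -> _ /=; exact: ed_lt.
Qed.

End ExtendCoordinates.

(** * Directed unions of direct summands *)

Section SummandChains.
Variables (S : pzRingType) (N : lmodType S).
Implicit Types (A : set N).

Lemma direct_summand0 A : direct_summand A -> A 0.
Proof. by case=> /submodule0. Qed.

Lemma chain_union_submodule T (lt : T -> T -> Prop) (B : T -> set N) :
  strict_wo lt -> inhabited T -> (forall i j, lt i j -> B i `<=` B j) ->
  (forall i, submodule (B i)) -> submodule (\bigcup_i B i).
Proof.
move=> [_ _ tot] [i0] Bmono Bsub; apply: submodule_intro.
  by exists i0 => //; exact: submodule0.
move=> a x y [i _ Bx] [j _ By]; case: (tot i j) => [ij|ij|ji].
- by exists j => //; apply: submoduleP => //; exact: Bmono Bx.
- by exists j => //; apply: submoduleP => //; rewrite -ij.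
- by exists i => //; apply: submoduleP => //; exact: Bmono By.
Qed.

Section Strata.
Variables (mu : choiceType) (lt : mu -> mu -> Prop) (B : mu -> set N).
Hypotheses (mu_wo : strict_wo lt) (mu0 : inhabited mu)
  (Bmono : forall i j, lt i j -> B i `<=` B j).

(** Zero is added so that this is the zero submodule when no index lies below [f]. *)
Definition lower_union f : set N := [set x | x = 0 \/ exists2 i, lt i f & B i x].

Hypotheses (Bsummand : forall i, direct_summand (B i))
  (lower_summand : forall f, direct_summand (lower_union f)).

(** [e i] projects [N] onto a complement of [lower_union i] in [B i]: first onto [B i], then away
    from the lower union. *)
Lemma strata_exist : exists e : mu -> {linear N -> N},
  [/\ forall i v, e i (e i v) = e i v, forall i v, B i (e i v),
      forall i x, lower_union i x -> e i x = 0 &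
      forall i x, B i x -> lower_union i (x - e i x)].
Proof.
have /choice[b bP] := fun i => (direct_summandP _).1 (Bsummand i).
have /choice[a aP] := fun i => (direct_summandP _).1 (lower_summand i).
have loB i x : lower_union i x -> B i x.
  by move=> [->|[k /Bmono ki /ki//]]; exact: direct_summand0.
have Be i v : B i (b i v - a i (b i v)).
  apply: submoduleB; first by case: (Bsummand i).
    exact: (bP i).1.
  by apply: loB; exact: (aP i).1.
exists (fun i => (idfun \- a i) \o b i : {linear N -> N}); split => //= i v.
- rewrite ((bP i).2 _ (Be i v)) linearB.
  by rewrite ((aP i).2 _ ((aP i).1 _)) subrr subr0.
- by move=> /[dup] /loB vB vlo; rewrite (bP i).2// (aP i).2// subrr.
- by move=> vB; rewrite (bP i).2// opprB addrCA subrr addr0; exact: (aP i).1.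
Qed.

Variable e : mu -> {linear N -> N}.
Hypotheses (e_idem : forall i v, e i (e i v) = e i v) (eB : forall i v, B i (e i v))
  (e_lower : forall i x, lower_union i x -> e i x = 0)
  (e_step : forall i x, B i x -> lower_union i (x - e i x)).

(** Transfinite induction: [x] differs from [e i x] by zero or by an element of an earlier [B k]. *)
Lemma strata_generate (P : set N) i : submodule P ->
  (forall k v, k = i \/ lt k i -> P (e k v)) -> B i `<=` P.
Proof.
move=> Psub; have [wf tr _] := mu_wo.
elim/(well_founded_ind wf): i => i IH Pe x Bx.
rewrite -(subrK (e i x) x); apply: submoduleD => //; last by apply: Pe; left.
have [->|[k ki Bk]] := e_step Bx; first exact: submodule0.
by apply: (IH k) Bk => // l v [->|lk]; apply: Pe; right => //; exact: tr ki.
Qed.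

(** At the largest index [m] of the support, [e m] kills all other terms of the sum and leaves
    [z m]. *)
Lemma strata_independent (z : dsum mu N) (s : {linear dsum mu N -> N}) :
  (forall i v, s (dsum_in i v) = v) -> (forall i, e i (z i) = z i) -> s z = 0 -> z = 0.
Proof.
move=> sP ez sz; have [_ tr tot] := mu_wo.
have [r ur rz] := dsum_supp z.
apply: contrapT => nz.
have [m zm mmax] : exists2 m, z m <> 0 & forall i, i \in r -> z i <> 0 -> lt i m \/ i = m.
  have [i0 zi0] : exists i, z i <> 0.
    by apply: contrapT => n; apply: nz; apply: dsum_ext => i; apply: contrapT => zi;
      apply: n; exists i.
  elim: r {ur rz} => [|i r [m zm mmax]]; first by exists i0.
  have [zi|/eqP zi] := eqVneq (z i) 0.
    by exists m => // k; rewrite inE => /orP[/eqP->//|]; exact: mmax.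
  case: (tot i m) => [im|im|mi].
  - by exists m => // k; rewrite inE => /orP[/eqP->|]; [left|exact: mmax].
  - by exists m => // k; rewrite inE => /orP[/eqP->|]; [right|exact: mmax].
  - exists i => // k; rewrite inE => /orP[/eqP->|kr zk]; first by right.
    by left; have [km|->//] := mmax k kr zk; exact: tr mi.
have := congr1 (e m) sz; rewrite linear0 (dsum_expand ur rz) !linear_sum.
rewrite (@sum_seq1 _ _ _ _ m)//.
- by rewrite sP ez.
- move=> i im; rewrite sP; have [->|/eqP zi] := eqVneq (z i) 0; first exact: linear0.
  apply: e_lower; right; exists i; last by rewrite -ez; exact: eB.
  by have [//|/eqP] := mmax i (rz i zi) zi; rewrite (negbTE im).
- by rewrite sP ez => _; exact: rz.
Qed.

(** The images of the [e k] with [k] below [f] decompose the summand [lower_union f] directly.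
    Coordinates are read off there after projecting [N] onto it. *)
Lemma strata_coordinates f : exists q : {linear N -> dsum mu N},
  forall k, lt k f -> forall v, q (e k v) = dsum_in k (e k v).
Proof.
have [_ tr _] := mu_wo.
(* [p] adds up the components in the strata and [u] records them; independence makes [u] factor
   through [p]. *)
have [p pP] := dsum_lift (fun i =>
  if pselect (lt i f) is left _ then e i else \0 : {linear N -> N}).
have [u uP] := dsum_lift (fun i =>
  if pselect (lt i f) is left _
  then (@dsum_in S mu N i \o e i : {linear N -> dsum mu N}) else \0).
have [s sP] := dsum_lift (fun _ : mu => idfun : {linear N -> N}).
have su y : s (u y) = p y.
  apply: (@dsum_linear_ext _ _ _ _ (s \o u : {linear _ -> _}) p) => i v /=.
  by rewrite uP pP; case: pselect => //= _; rewrite ?sP ?linear0.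
have eu y i : e i (u y i) = u y i.
  apply: (@dsum_submodule_ind _ _ _ [set y | e i (u y i) = u y i]) => [|k _ v /=].
    apply: submodule_intro => [|a x x' /= ex ex']; first by rewrite /= !linear0.
    by rewrite linearP dsumD dsumZ linearP ex ex'.
  rewrite uP; case: pselect => [_|_] /=; last exact: linear0.
  by case: eqP => [->|_]; rewrite ?e_idem ?linear0.
have Lsub : submodule (lower_union f) by case: (lower_summand f).
have [U [j [jinj jrange]]] := submodule_type Lsub.
have pL y : lower_union f (p y).
  apply: (@dsum_submodule_ind _ _ _ [set y | lower_union f (p y)]) => [|k _ v /=].
    apply: submodule_intro => [|a x x' /= ex ex'].
      by rewrite /= linear0; exact: submodule0.
    by rewrite linearP; exact: submoduleP.
  by rewrite pP; case: pselect => [kf|_] /=; [right; exists k|left].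
have [pU pUP] : exists pU : {linear dsum mu N -> U}, forall y, j (pU y) = p y.
  by apply: linear_corestrict => // y; have := pL y; rewrite -jrange => -[x _ xE]; exists x.
have pUsurj x : exists y, pU y = x.
  suff : range p (j x) by case=> y _ yx; exists y; apply: jinj; rewrite pUP.
  have : lower_union f (j x) by rewrite -jrange; exists x.
  move=> [->|[i if_ Bi]]; first by exists 0 => //; rewrite linear0.
  apply: strata_generate Bi; first exact: submodule_range.
  move=> k v ki; exists (dsum_in k v) => //; rewrite pP; case: pselect => // -[].
  by case: ki => [->//|ki]; exact: tr if_.
have [|t tP] := linear_factor (u := u) pUsurj.
  move=> y pUy; apply: (strata_independent sP (eu y)).
  by rewrite su -pUP pUy linear0.
have [a [aL aid]] := (direct_summandP _).1 (lower_summand f).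
have [aU aUP] : exists aU : {linear N -> U}, forall x, j (aU x) = a x.
  by apply: linear_corestrict => // y; have := aL y; rewrite -jrange => -[x _ xE]; exists x.
exists (t \o aU : {linear _ -> _}) => k kf v /=.
have -> : aU (e k v) = pU (dsum_in k (e k v)).
  apply: jinj; rewrite aUP pUP pP aid; last by right; exists k.
  by case: pselect => // _; rewrite e_idem.
by rewrite tP uP; case: pselect => // _ /=; rewrite e_idem.
Qed.

(** The projection is [q] followed by summation; it fixes every [B i] because it fixes all
    strata. *)
Lemma strata_union_summand (q : {linear N -> dsum mu N}) :
  (forall k v, q (e k v) = dsum_in k (e k v)) -> direct_summand (\bigcup_i B i).
Proof.
move=> qP; have [s sP] := dsum_lift e.
have Bsub i : submodule (B i) by case: (Bsummand i).
have Usub := chain_union_submodule mu_wo mu0 Bmono Bsub.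
apply/direct_summandP; exists (s \o q : {linear _ -> _}); split => [x|x [i _ Bx]].
  apply: (@dsum_submodule_ind _ _ _ [set y | (\bigcup_i B i) (s y)]) => [|k _ v /=].
    apply: submodule_intro => [|a y y' /= ey ey'].
      by rewrite /= linear0; exact: submodule0.
    by rewrite linearP; exact: submoduleP.
  by rewrite sP; exists k.
apply: (@strata_generate [set x | (s \o q) x = x] i) Bx => [|k v _].
  apply: submodule_intro => [|a y y' /= ey ey']; first by rewrite /= !linear0.
  by rewrite !linearP ey ey'.
by rewrite /= qP sP e_idem.
Qed.

End Strata.
End SummandChains.

Section DirectedUnions.
Hypothesis star : proper_class_of_cardinals has_nonreflecting_subsets.
Variables (S : pzRingType) (M : lmodType S).
Hypothesis covers : forall L : lmodType S, in_lim (in_Add M) L -> has_cover (in_Add M) L.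
Variable N : lmodType S.
Hypothesis NAdd : in_Add M N.

Lemma limit_chain_summand (mu : choiceType) (lt : mu -> mu -> Prop) (B : mu -> set N) :
  strict_wo lt -> inhabited mu -> (forall i j, lt i j -> B i `<=` B j) ->
  (forall i, exists j, lt i j) -> (forall i, direct_summand (B i)) ->
  (forall f, direct_summand (lower_union lt B f)) -> direct_summand (\bigcup_i B i).
Proof.
move=> wo mu0 Bmono nomax BS LS.
have [e [e_idem eB e_lower e_step]] := strata_exist Bmono BS LS.
have e_coord := strata_coordinates wo LS e_idem eB e_lower e_step.
have [q qP] := coordinates_extend star covers NAdd wo mu0 nomax e_idem e_coord.
exact: (strata_union_summand wo mu0 Bmono BS e_idem eB e_step qP).
Qed.

Lemma chain_summand (T : Type) (lt : T -> T -> Prop) (B : T -> set N) :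
  strict_wo lt -> inhabited T -> (forall i j, lt i j -> B i `<=` B j) ->
  (forall i, direct_summand (B i)) -> direct_summand (\bigcup_i B i).
Proof.
elim/Pchoice: T => T in lt B *; move=> wo T0 Bmono BS; have [wf tr tot] := wo.
(* A segment with a last index [m] has union [B m]; one without is the limit case, once its lower
   unions are summands. Well-founded induction then supplies the lower unions. *)
have initial (D : set T) : D !=set0 -> (forall i j, lt i j -> D j -> D i) ->
    (forall f, D f -> direct_summand (lower_union lt B f)) ->
    direct_summand (\bigcup_(i in D) B i).
  move=> [d0 Dd0] Ddown DL.
  have [[m [Dm mmax]]|nmax] := pselect (exists m, D m /\ forall k, D k -> ~ lt m k).
    have -> : \bigcup_(i in D) B i = B m; last exact: BS.
    apply/seteqP; split => [x [i Di Bx]|x Bx]; last by exists m.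
    case: (tot i m) => [im|<-//|mi]; first exact: Bmono Bx.
    by case: (mmax i Di).
  have := @limit_chain_summand (set_type D) (fun x y => lt (val x) (val y))
    (fun x => B (val x)) (strict_wo_sub D wo).
  have -> : \bigcup_(i in D) B i = \bigcup_(x : set_type D) B (val x).
    apply/seteqP; split => [x [i Di Bx]|x [[i Di] _ Bx]].
      by exists (exist _ i (mem_set Di)).
    by exists i => //; exact: set_mem.
  apply.
  - exact: (inhabits (exist _ d0 (mem_set Dd0))).
  - by move=> i j; exact: Bmono.
  - move=> [i Di]; apply: contrapT => n; apply: nmax; exists i; split; first exact: set_mem.
    by move=> k Dk ik; apply: n; exists (exist _ k (mem_set Dk)).
  - by move=> i; exact: BS.
  move=> [f Df] /=; have := DL f (set_mem Df); congr direct_summand.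
  apply/seteqP; split => [x [->|[i if_ Bx]]|x [->|[[i Di] if_ Bx]]]; try by left.
    by right; exists (exist _ i (mem_set (Ddown _ _ if_ (set_mem Df)))).
  by right; exists i.
apply: (initial setT) => // [|f _]; first by have [i] := T0; exists i.
elim/(well_founded_ind wf): f => f IH.
have [[i0 if0]|n] := pselect (exists i, lt i f); last first.
  apply/direct_summandP; exists \0; split => [x|x [->//|[i if_]]]; first by left.
  by case: n; exists i.
have -> : lower_union lt B f = \bigcup_(i in [set i | lt i f]) B i.
  apply/seteqP; split => [x [->|[i if_ Bx]]|x [i if_ Bx]].
  - by exists i0 => //; exact: direct_summand0.
  - by exists i.
  - by right; exists i.
apply: initial => //; first by exists i0.
by move=> i j ij jf; exact: tr jf.
Qed.

Lemma directed_union_summand (I : Type) (F : I -> set N) : inhabited I ->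
  (forall i j, exists k, F i `<=` F k /\ F j `<=` F k) ->
  (forall i, direct_summand (F i)) -> direct_summand (\bigcup_i F i).
Proof.
apply: (@directed_union_of_chains N (@direct_summand S N)) => T lt B wo T0 Bmono BS.
exact: (chain_summand wo T0 Bmono BS).
Qed.

End DirectedUnions.

(** * Perfect decompositions and closure under direct limits *)

Section PerfectDecomposition.
Variable S : pzRingType.

Lemma subsum_mono (N : lmodType S) (I : choiceType) (A : I -> set N) (J J' : set I) :
  (forall i, submodule (A i)) -> J `<=` J' -> subsum A J `<=` subsum A J'.
Proof.
move=> sA JJ' _ [y [Ay yfin ->]].
exists (fun i => if `[< J i >] then y i else 0); split.
- by move=> i _; case: asboolP => [/Ay//|_]; exact: submodule0.
- by apply: sub_finite_set yfin => i [_ /=]; case: asboolP.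
rewrite -(@fsbig_widen _ _ _ _ J J')//.
  by apply: eq_fsbigr => i; rewrite inE => Ji; case: asboolP.
by move=> i [_ nJ] /=; case: asboolP.
Qed.

Lemma subsum_directed_union (N : lmodType S) (I : choiceType) (A : I -> set N) :
  (forall i, submodule (A i)) ->
  subsum A setT = \bigcup_(s : seq I) subsum A [set` s].
Proof.
move=> sA; apply/seteqP; split => [x|x [s _]]; last exact: subsum_mono.
move=> [y [Ay]]; rewrite setTI => /[dup] yfin /finite_seqP[s sE] ->.
exists s => //; exists y; split => //; first by move=> i _; exact: Ay.
  by apply: sub_finite_set yfin => i [].
apply/esym/fsbig_widen => // i [_ /= nis]; apply: contrapT => yi.
by apply: nis; have : (y @^-1` [set~ 0]) i by []; rewrite sE.
Qed.

Hypothesis star : proper_class_of_cardinals has_nonreflecting_subsets.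
Variable M : lmodType S.
Hypothesis covers : forall L : lmodType S, in_lim (in_Add M) L -> has_cover (in_Add M) L.

(** The full sum is the directed union of its finite subsums, which are summands by assumption. *)
Lemma covers_perfect_decomposition : perfect_decomposition M.
Proof.
move=> N NAdd I A [sA _ Afin]; rewrite subsum_directed_union//.
apply: (directed_union_summand star covers NAdd) => [|s t|s].
- exact: (inhabits [::]).
- exists (s ++ t); split; apply: subsum_mono => // i /= ist; rewrite mem_cat ist//.
  by rewrite orbT.
- exact/Afin/finite_seq.
Qed.

(* Embed all [F i] as retracts of one module [Q], and let [P] be the sum of copies
   of [Q] over [I].  For a finite set [t] of indices with upper bound [j], the
   vectors supported on [t] and [j] that vanish in [F j] form a summand of [P],
   and the directed union of these summands is the kernel of [P -> L]. *)
Lemma covers_lim_closed (L : lmodType S) : in_lim (in_Add M) L -> in_Add M L.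
Proof.
move=> [d [I [F [g [FAdd [gC gU]]]]]].
have /choice[Z ZP] := fun i => (in_AddP _ _).1 (FAdd i).
pose Q := dsum {i : I & Z i} M.
have FQ i : retract (F i) Q.
  apply: retract_trans (ZP i) _.
  have [f fP] := dsum_lift (fun z : Z i =>
    @dsum_in S {i : I & Z i} M (existT _ i z) : {linear M -> Q}).
  have [h hP] := dsum_lift (fun iz : {i : I & Z i} =>
    if pselect (exists z, iz = existT Z i z) is left H
    then @dsum_in S (Z i) M (sval (cid H)) : {linear M -> dsum (Z i) M} else \0).
  exists f, h => y; apply: (@dsum_linear_ext _ _ _ _ (h \o f : {linear _ -> _}) idfun) => z v /=.
  rewrite fP hP; case: pselect => [H|[]]; last by exists z.
  case: cid => z' /= zz'; congr (dsum_in _ v).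
  have : Tagged Z z == Tagged Z z' by apply/eqP.
  by rewrite eq_Tagged /= => /eqP.
pose s i := sval (cid (FQ i)); pose r i := sval (cid (proj2_sig (cid (FQ i)))).
have rsK i x : r i (s i x) = x by exact: (proj2_sig (cid (proj2_sig (cid (FQ i))))).
pose P := dsum I Q.
pose at_ i : {linear Q -> P} := @dsum_in S I Q i.
have PAdd : in_Add M P.
  by apply: in_Add_dsum; apply/in_AddP; exists {i : I & Z i}; exists idfun, idfun.
have [v vP] := dsum_lift (fun i => g i \o r i : {linear Q -> L}).
(* Other indices get the default zero; elements of [K] are supported at indices up to [j]. *)
have phi_ex j : exists phi : {linear P -> F j}, forall i (ij : (i <= j)%O) q,
    phi (at_ i q) = ds_map F ij (r i q).
  have [phi phiP] := dsum_lift (fun i =>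
    if pselect (i <= j)%O is left ij then (ds_map F ij \o r i : {linear Q -> F j}) else \0).
  exists phi => i ij q; rewrite phiP; case: pselect => // ij' /=.
  by rewrite (Prop_irrelevance ij' ij).
pose phi j := sval (cid (phi_ex j)).
have phiP j i (ij : (i <= j)%O) q : phi j (at_ i q) = ds_map F ij (r i q).
  by rewrite /phi; case: cid.
pose upto (t : seq I) j := forall i, i \in t -> (i <= j)%O.
pose K (tj : seq I * I) : set P := [set y : P | [/\ upto tj.1 tj.2,
  forall i, y i <> 0 -> i \in tj.2 :: tj.1 & phi tj.2 y = 0]].
have phi_above j k (jk : (j <= k)%O) (y : P) : (forall i, y i <> 0 -> (i <= j)%O) ->
    phi k y = ds_map F jk (phi j y).
  move=> yj; apply: (@dsum_submodule_ind _ _ _ [set y : P | phi k y = ds_map F jk (phi j y)])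
    => [|i /yj ij q /=].
    apply: submodule_intro => [|a x x' /= ex ex']; first by rewrite /= !linear0.
    by rewrite !linearP ex ex'.
  rewrite (phiP _ _ (le_trans ij jk)) (phiP _ _ ij).
  exact/esym/(ds_map_comp ij jk (le_trans ij jk)).
have v_phi j (y : P) : (forall i, y i <> 0 -> (i <= j)%O) -> v y = g j (phi j y).
  move=> yj; apply: (@dsum_submodule_ind _ _ _ [set y : P | v y = g j (phi j y)])
    => [|i /yj ij q /=].
    apply: submodule_intro => [|a x x' /= ex ex']; first by rewrite /= !linear0.
    by rewrite !linearP ex ex'.
  by rewrite (phiP _ _ ij) vP /= -(gC _ _ ij).
have K_le t j (y : P) : K (t, j) y -> forall i, y i <> 0 -> (i <= j)%O.
  by move=> [/= tj yt _] i /yt; rewrite inE => /orP[/eqP->//|/tj].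
have K_summand t j : upto t j -> direct_summand (K (t, j)).
  move=> tj; apply/direct_summandP.
  pose chi : {linear P -> P} := dsum_restrict [set i | i \in j :: t].
  (* Subtracting the value in [F j], placed back at [j] by the section [s j], makes [phi j] vanish;
     for this [j] itself is allowed in the support. *)
  exists (chi \- (at_ j \o (s j \o (phi j \o chi))) : {linear P -> P}); split => [y|y].
    split => //= [i|].
      rewrite -[X in X <> 0]/(chi y i - at_ j (s j (phi j (chi y))) i).
      rewrite /chi dsum_restrictE dsum_inE.
      case: asboolP => //= ni; case: eqP => [ij|]; last by rewrite subrr.
      by case: ni; rewrite /= ij inE eqxx.
    by rewrite linearB (phiP _ _ (lexx j)) ds_map_id rsK subrr.
  move=> [/= _ ys y0]; have chiy : chi y = y by exact: dsum_restrict_id.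
  by rewrite /= chiy y0 !linear0 addr0.
have [i0] : inhabited I by exact: ds_inhabited F.
pose Kset := \bigcup_(tj : {tj : seq I * I | upto tj.1 tj.2}) K (sval tj).
have KI t j y : K (t, j) y -> Kset y.
  by move=> Ky; have [tj _ _] := Ky; exists (exist (fun tj => upto tj.1 tj.2) (t, j) tj).
have Ksummand : direct_summand Kset.
  apply: (directed_union_summand star covers PAdd).
  - have H : upto (@nil I, i0).1 (@nil I, i0).2 by [].
    exact: (inhabits (exist (fun tj => upto tj.1 tj.2) (@nil I, i0) H)).
  - move=> [[t j] /= tj] [[t' j'] /= tj'].
    have [k /andP[jk jk']] := ds_directed F j j'.
    have H : upto ((j :: t) ++ (j' :: t'), k).1 ((j :: t) ++ (j' :: t'), k).2.
      move=> i /=; rewrite inE mem_cat inE => /or3P[/eqP->//|it|/orP[/eqP->//|it']].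
        exact: le_trans (tj _ it) jk.
      exact: le_trans (tj' _ it') jk'.
    exists (exist (fun tj => upto tj.1 tj.2) _ H); split => y Ky; split => //.
    - by case: Ky => _ ys _ i /ys it; rewrite inE mem_cat it orbT.
    - rewrite /= (phi_above _ _ jk _ (K_le _ _ _ Ky)).
      by case: Ky => _ _ /= ->; rewrite linear0.
    - by case: Ky => _ ys _ i /ys it; rewrite inE mem_cat it !orbT.
    - rewrite /= (phi_above _ _ jk' _ (K_le _ _ _ Ky)).
      by case: Ky => _ _ /= ->; rewrite linear0.
  - by move=> [[t j] /= tj]; exact: K_summand.
have v0 y : Kset y -> v y = 0.
  move=> [[[t j] /= tj] _ Ky]; rewrite (v_phi _ _ (K_le _ _ _ Ky)).
  by case: Ky => _ _ /= ->; rewrite linear0.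
have [E [EK Eid]] := (direct_summandP _).1 Ksummand.
(* [1 - E] kills [Kset], and an element placed at [i] differs by an element of [Kset] from its image
   placed at [j]; hence these maps form a cocone. *)
pose h i : {linear F i -> P} := (idfun \- E) \o (at_ i \o s i).
have hC : cocone h.
  move=> i j ij x; pose a := at_ j (s j (ds_map F ij x)); pose b := at_ i (s i x).
  have Ky : K ([:: i], j) (a - b).
    split => [k|k|]; first by rewrite /= inE => /eqP->.
      rewrite -[(a - b) k]/(a k - b k) !dsum_inE /= !inE.
      by case: (k == j); case: (k == i); rewrite ?subrr.
    by rewrite /= linearB (phiP _ _ (lexx j)) (phiP _ _ ij) ds_map_id !rsK subrr.
  rewrite -[LHS]/(a - E a) -[RHS]/(b - E b) -(subrK b a) linearD.
  by rewrite (Eid _ (KI _ _ _ Ky)) opprD addrACA subrr add0r.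
have [u [uP _]] := gU P h hC.
(* Both [v \o u] and the identity are compatible with [g], so both equal [w], and [u] is a section
   of [v]. *)
have [w [_ wP]] := gU L g gC.
apply: in_Add_retract PAdd; exists u, v => x.
have -> : v (u x) = w x.
  apply: (wP (v \o u : {linear _ -> _})) => i y /=.
  have /= -> := uP i y; rewrite linearB (v0 (E _))// subr0.
  by rewrite vP /= rsK.
by rewrite -(wP (idfun : {linear L -> L})).
Qed.

End PerfectDecomposition.

Theorem theorem2p2
  (star : proper_class_of_cardinals has_nonreflecting_subsets)
  (R : pzRingType) (M : lmodType R^c)
  (covers : forall L : lmodType R^c,
     in_lim (in_Add M) L -> has_cover (in_Add M) L) :
  perfect_decomposition M /\
  (forall L : lmodType R^c,
     in_lim (in_Add M) L -> in_Add M L).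
Proof.
split; first exact: (covers_perfect_decomposition star covers).
exact: (covers_lim_closed star covers).
Qed.
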